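(* There exist an absolute constant $c>0$ and functions $C:[1,2)\to(0,\infty)$ with $C(p)\ge c\,(2-p)$ and $C':[1,2]\to(0,\infty)$ with $C'(p)\ge c$ such that the following hold for every $n\ge1$. (i) For every $A\in M_2(\mathbb{C})^{\otimes n}$ with $\|A\|_{\infty}\leq 1$ and every $1\le p<2$, $$\mathcal{E}_p[A] \geq C(p)\, \mathrm{Var}(A) \left[1+ \frac{1}{2}\ln \left(\frac{1}{\mathrm{Var}(A)}\right)\right]^{p/2}.$$ (ii) For every quantum Boolean function $A\in M_2(\mathbb{C})^{\otimes n}$ (that is, $A^*=A$ and $A^2=\mathbf 1$) and every $1\le p\le 2$, $$\mathcal{E}_p[A] \geq C'(p)\, \mathrm{Var}(A) \left[1+ \frac{1}{2}\ln \left(\frac{1}{\mathrm{Var}(A)}\right)\right]^{p/2}.$$ Here, if $\mathrm{Var}(A)=0$, the right-hand sides are understood to equal $0$.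
   Context: On $M_2(\mathbb{C})^{\otimes n}\cong M_{2^n}(\mathbb{C})$ let $\tau=2^{-n}\mathrm{tr}$ be the normalized trace, $|A|=(A^*A)^{1/2}$, $\|A\|_p=\tau(|A|^p)^{1/p}$ for $1\le p<\infty$, and $\|A\|_\infty$ the operator norm. $\mathrm{Var}(A)=\|A-\tau(A)\mathbf 1\|_2^2$. For $j\in[n]=\{1,\dots,n\}$, $\tau_j$ is the map acting as $\frac12\mathrm{tr}(\cdot)\mathbf 1$ on the $j$-th tensor factor and as the identity on the other factors, and $d_j A=A-\tau_j(A)$. Let $|\nabla A|=\left(\sum_{j=1}^n|d_jA|^2\right)^{1/2}$ and $\mathcal{E}_p[A]=\||\nabla A|\|_p^p$. *)

(* Defs.v *)
From HB Require Import structures.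
From mathcomp Require Import all_boot all_order all_algebra.
From mathcomp Require Import complex.
From mathcomp Require Import all_classical all_reals all_analysis.

Set Implicit Arguments.
Unset Strict Implicit.
Unset Printing Implicit Defensive.

Import Order.TTheory GRing.Theory Num.Theory.

Local Open Scope ring_scope.
Local Open Scope complex_scope.
Local Open Scope sesquilinear_scope.

(* The standard basis of (C^2)^{(x)n} is indexed by the strings in {0,1}^n,    *)
(* which are numbered by enum_rank / enum_val; thus qdim n = 2 ^ n.            *)
Definition bitstr (n : nat) := {ffun 'I_n -> 'I_2}.

Definition qdim (n : nat) : nat := #|{: bitstr n}|.

Lemma qdimE n : qdim n = (2 ^ n)%N.
Proof. by rewrite /qdim card_ffun !card_ord. Qed.

Definition bits (n : nat) (a : 'I_(qdim n)) : bitstr n := enum_val a.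

Definition unbits (n : nat) (x : bitstr n) : 'I_(qdim n) := enum_rank x.

(* M_2(C)^{(x)n} *)
Notation qop R n := 'M[R[i]]_(qdim n).

Definition setbit (n : nat) (x : bitstr n) (j : 'I_n) (b : 'I_2) : bitstr n :=
  [ffun k => if k == j then b else x k].

(* A_0 (x) ... (x) A_{n-1}, with entries prod_j (A_j)_{x_j, y_j}. *)
Definition tensor (R : realType) (n : nat) (F : 'I_n -> 'M[R[i]]_2) : qop R n :=
  \matrix_(a, b) \prod_(j < n) F j (bits a j) (bits b j).

(* tau_j, by its matrix entries; tauj_tensor and tensor_span below show that   *)
(* it is the linear map acting as (1/2) tr(.) 1 on the j-th tensor factor and  *)
(* as the identity on the other ones.                                         *)
Definition tauj (R : realType) (n : nat) (j : 'I_n) (A : qop R n) : qop R n :=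
  \matrix_(a, b)
    (if bits a j == bits b j then
       2^-1 * \sum_(s < 2) A (unbits (setbit (bits a) j s))
                          (unbits (setbit (bits b) j s))
     else 0).

Definition dj (R : realType) (n : nat) (j : 'I_n) (A : qop R n) : qop R n :=
  A - tauj j A.

(* Functional calculus U^{-1} diag(f(lambda)) U for a Hermitian matrix         *)
(* U^{-1} diag(lambda) U, with U unitary and lambda real. It is only used on   *)
(* positive semidefinite matrices.                                            *)
Definition mxfun (R : realType) (m : nat) (f : R -> R) (A : 'M[R[i]]_m)
    : 'M[R[i]]_m :=
  invmx (spectralmx A)
  *m diag_mx (map_mx (fun z : R[i] => (f (complex.Re z))%:C) (spectral_diag A))
  *m spectralmx A.

Definition absmx (R : realType) (m : nat) (A : 'M[R[i]]_m) : 'M[R[i]]_m :=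
  mxfun Num.sqrt (A ^t* *m A).

Definition ntrace (R : realType) (n : nat) (A : qop R n) : R[i] :=
  (2 ^+ n)^-1 * \tr A.

(* ||A||_p for 1 <= p < oo; the trace of |A|^p is a nonnegative real. *)
Definition pnorm (R : realType) (n : nat) (p : R) (A : qop R n) : R :=
  complex.Re (ntrace (mxfun (fun t => t `^ p) (absmx A))) `^ p^-1.

Definition l2norm (R : realType) (m : nat) (v : 'cV[R[i]]_m) : R :=
  Num.sqrt (\sum_(k < m) complex.Re `|v k 0| ^+ 2).

Definition opnorm (R : realType) (m : nat) (A : 'M[R[i]]_m) : R :=
  sup [set l2norm (A *m v) | v in [set v : 'cV[R[i]]_m | l2norm v <= 1]]%classic.

Definition qvar (R : realType) (n : nat) (A : qop R n) : R :=
  pnorm 2 (A - (ntrace A)%:M) ^+ 2.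

Definition gradmx (R : realType) (n : nat) (A : qop R n) : qop R n :=
  mxfun Num.sqrt (\sum_(j < n) absmx (dj j A) *m absmx (dj j A)).

Definition energy (R : realType) (n : nat) (p : R) (A : qop R n) : R :=
  pnorm p (gradmx A) `^ p.

Definition quantum_boolean (R : realType) (n : nat) (A : qop R n) : Prop :=
  A ^t* = A /\ A *m A = 1%:M.

(* v [1 + (1/2) ln(1/v)]^{p/2}, with value 0 at v = 0. *)
Definition log_bound (R : realType) (p v : R) : R :=
  if v == 0 then 0 else v * (1 + 2^-1 * ln (1 / v)) `^ (p / 2).

Lemma tauj_is_linear (R : realType) (n : nat) (j : 'I_n) :
  linear (@tauj R n j).
Proof.
move=> c A B; apply/matrixP => a b; rewrite !mxE.
case: eqP => _; last by rewrite mulr0 addr0.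
rewrite mulrCA -mulrDr; congr (_ * _).
by rewrite mulr_sumr -big_split; apply: eq_bigr => s _; rewrite !mxE.
Qed.

Lemma tauj_tensor (R : realType) (n : nat) (j : 'I_n)
    (F : 'I_n -> 'M[R[i]]_2) :
  tauj j (tensor F)
  = tensor (fun k => if k == j then (2^-1 * \tr (F j))%:M else F k).
Proof.
apply/matrixP => a b; rewrite !mxE [RHS](bigD1 j) //= eqxx.
set P := \prod_(_ < _ | _) _.
have PE : P = \prod_(k < n | k != j) F k (bits a k) (bits b k).
  by apply: eq_bigr => k /negbTE ->.
rewrite mxE; case: eqP => _; last by rewrite mulr0n mul0r.
rewrite mulr1n -mulrA PE; congr (_ * _); rewrite /mxtrace mulr_suml.
apply: eq_bigr => s _; rewrite mxE /bits /unbits !enum_rankK.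
rewrite (bigD1 j) //= !ffunE eqxx.
by congr (_ * _); apply: eq_bigr => k /negbTE kj; rewrite !ffunE kj.
Qed.

Lemma tensor_span (R : realType) (n : nat) (A : qop R n) :
  A = \sum_a \sum_b A a b *:
        tensor (fun j => delta_mx (bits a j) (bits b j)).
Proof.
rewrite {1}[A]matrix_sum_delta; apply: eq_bigr => a _; apply: eq_bigr => b _.
congr (_ *: _); apply/matrixP => c d; rewrite !mxE.
have [/andP[/eqP-> /eqP->]|] := boolP ((c == a) && (d == b)).
  by rewrite big1 // => j _; rewrite mxE !eqxx.
move=> neq; apply/esym/eqP; apply: contraNT neq => /prodf_neq0 H.
have E j : (bits c j == bits a j) && (bits d j == bits b j).
  by have := H j isT; rewrite mxE; case: (_ && _); rewrite //= eqxx.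
by apply/andP; split; apply/eqP/enum_val_inj/ffunP => j;
  case/andP: (E j) => /eqP ? /eqP ?.
Qed.

(* Main.v *)
Require Import Defs.
From HB Require Import structures.
From mathcomp Require Import all_boot all_order all_algebra.
From mathcomp Require Import complex.
From mathcomp Require Import all_classical all_reals all_analysis.
From mathcomp Require Import ring lra.

Set Implicit Arguments.
Unset Strict Implicit.
Unset Printing Implicit Defensive.

Import Order.TTheory GRing.Theory Num.Theory.
Import numFieldNormedType.Exports.

Local Open Scope ring_scope.
Local Open Scope complex_scope.
Local Open Scope sesquilinear_scope.

(** The proof follows the variance of [A] under noise. Let [qnoise r] be the
    tensor power of the one-qubit depolarizing map that keeps a correlation [r];
    it interpolates between the identity at [r = 1] and the normalized trace at
    [r = 0]. Write [v] for the variance of [A] and [x = ln (1 / v)].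

    The noise destroys little variance when the energy is small. Indeed the
    derivative in [t] of the pairing of [f] with [qnoise t h] is a pairing of
    gradients, and [reverse_poincare] bounds the gradient of [qnoise t h] by the
    operator norm of [h] divided by [sqrt (t * (1 - t))]. In an eigenbasis of the
    squared gradient of [f] the pairing of gradients becomes a scalar sum, to
    which a truncated Young inequality applies. Integration over [t] gives
    [short_time_variance]: up to a fraction of the variance of [h], the pairing
    of [f] with [h - qnoise r h] is at most a constant times
    [energy p f * L ^ (2 - p) * (1 - r) ^ (p / 2)] when [h] is bounded by [L].

    Conversely, suppose that the singular values of [A - tau(A)] above
    [v ^ (1 / 4)] carry most of the variance. They are sparse, so that
    [hypercontractivity] between the 2-norm and the 4-norm shows that noise of
    constant strength reduces their part of the variance by a factor
    [v ^ (1 / 8)]; by log-convexity noise of strength [1 - r] of order [1 / x]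
    already reduces it by a constant factor ([noise_decay]). Comparison with
    [short_time_variance] for [f = h = A] yields an energy of order at least
    [v * x ^ (p / 2)], with constants independent of [p].

    In the remaining case a fixed part of the variance is carried by the part
    [h] of [A] whose singular values are at most [v ^ (1 / 4)]. Then
    [short_time_variance] for this [h] and [r = 0] yields an energy of order at
    least [v * exp ((2 - p) * x / 4)], and this is where the factor [2 - p] in
    the constant comes from. For a Boolean observable this case does not arise:
    apart from singular values larger than [1], the centered observable only has
    singular values at most [v]. *)

(** * The Hilbert-Schmidt pairing and quadratic forms *)

Section HilbertSchmidt.
Variable R : realType.
Implicit Types m n : nat.

Lemma ReD (x y : R[i]) : complex.Re (x + y) = complex.Re x + complex.Re y.
Proof. by case: x y => [a b] [c d]. Qed.

Lemma ReN (x : R[i]) : complex.Re (- x) = - complex.Re x.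
Proof. by case: x. Qed.

Lemma ReZ (c : R) (x : R[i]) : complex.Re (c%:C * x) = c * complex.Re x.
Proof. by case: x => a b /=; rewrite mul0r subr0. Qed.

Lemma Re_sum (I : Type) (r : seq I) (P : pred I) (F : I -> R[i]) :
  complex.Re (\sum_(i <- r | P i) F i) = \sum_(i <- r | P i) complex.Re (F i).
Proof. by apply: (big_morph _ ReD). Qed.

Definition adj m n (A : 'M[R[i]]_(m, n)) : 'M[R[i]]_(n, m) := A ^t*.

Lemma adjE m n (A : 'M[R[i]]_(m, n)) i j : adj A i j = (A j i)^*.
Proof. by rewrite !mxE. Qed.

Lemma adjK m n (A : 'M[R[i]]_(m, n)) : adj (adj A) = A.
Proof. exact: trmxCK. Qed.

Lemma adjM m n k (A : 'M[R[i]]_(m, n)) (B : 'M[R[i]]_(n, k)) :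
  adj (A *m B) = adj B *m adj A.
Proof. by rewrite /adj trmx_mul map_mxM. Qed.

Lemma adjD m n (A B : 'M[R[i]]_(m, n)) : adj (A + B) = adj A + adj B.
Proof. by apply/matrixP => i j; rewrite !mxE rmorphD. Qed.

Lemma adjB m n (A B : 'M[R[i]]_(m, n)) : adj (A - B) = adj A - adj B.
Proof. by apply/matrixP => i j; rewrite !mxE rmorphB. Qed.

Lemma adj0 m n : adj (0 : 'M[R[i]]_(m, n)) = 0.
Proof. by apply/matrixP => i j; rewrite !mxE rmorph0. Qed.

Lemma adjZ m n (c : R) (A : 'M[R[i]]_(m, n)) : adj (c%:C *: A) = c%:C *: adj A.
Proof.
by apply/matrixP => i j; rewrite !mxE rmorphM /= -[X in X * _]/(c%:C^*) conjc_real.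
Qed.

Lemma adj1 n : adj (1%:M : 'M[R[i]]_n) = 1%:M.
Proof. by apply/matrixP => i j; rewrite !mxE rmorph_nat eq_sym. Qed.

Lemma adj_sum m n (I : Type) (r : seq I) (P : pred I) (F : I -> 'M[R[i]]_(m, n)) :
  adj (\sum_(i <- r | P i) F i) = \sum_(i <- r | P i) adj (F i).
Proof. exact: (big_morph _ (@adjD m n) (adj0 m n)). Qed.

Definition hs m n (A B : 'M[R[i]]_(m, n)) : R := complex.Re (\tr (adj A *m B)).

Section Bilinear.
Variables (m n : nat).
Implicit Types A B D : 'M[R[i]]_(m, n).

Lemma hsE A B : hs A B = \sum_j \sum_i complex.Re ((A i j)^* * B i j).
Proof.
rewrite /hs /mxtrace Re_sum; apply: eq_bigr => j _.
by rewrite mxE Re_sum; apply: eq_bigr => i _; rewrite adjE.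
Qed.

Lemma hsC A B : hs A B = hs B A.
Proof.
rewrite !hsE; apply: eq_bigr => j _; apply: eq_bigr => i _.
by case: (A i j) (B i j) => [a b] [c d] /=; ring.
Qed.

Lemma hsDr A B D : hs A (B + D) = hs A B + hs A D.
Proof. by rewrite /hs mulmxDr mxtraceD ReD. Qed.

Lemma hsNr A B : hs A (- B) = - hs A B.
Proof. by rewrite /hs mulmxN raddfN ReN. Qed.

Lemma hsBr A B D : hs A (B - D) = hs A B - hs A D.
Proof. by rewrite hsDr hsNr. Qed.

Lemma hsZr A (c : R) B : hs A (c%:C *: B) = c * hs A B.
Proof. by rewrite /hs -scalemxAr mxtraceZ ReZ. Qed.

Lemma hsDl A B D : hs (B + D) A = hs B A + hs D A.
Proof. by rewrite hsC hsDr !(hsC A). Qed.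

Lemma hsBl A B D : hs (B - D) A = hs B A - hs D A.
Proof. by rewrite hsC hsBr !(hsC A). Qed.

Lemma hsZl A (c : R) B : hs (c%:C *: B) A = c * hs B A.
Proof. by rewrite hsC hsZr !(hsC A). Qed.

Lemma hs0r A : hs A 0 = 0.
Proof. by rewrite /hs mulmx0 mxtrace0. Qed.

Lemma hs_sumr A (I : Type) (r : seq I) (P : pred I) (F : I -> 'M[R[i]]_(m, n)) :
  hs A (\sum_(i <- r | P i) F i) = \sum_(i <- r | P i) hs A (F i).
Proof. exact: (big_morph _ (hsDr A) (hs0r A)). Qed.

Lemma hs_norm2 A : hs A A = \sum_j \sum_i (complex.Re `|A i j|) ^+ 2.
Proof.
rewrite hsE; apply: eq_bigr => j _; apply: eq_bigr => i _.
case: (A i j) => a b; rewrite normc_def /= sqr_sqrtr ?addr_ge0 ?sqr_ge0 //.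
ring.
Qed.

Lemma hs_ge0 A : 0 <= hs A A.
Proof.
by rewrite hs_norm2; apply: sumr_ge0 => j _; apply: sumr_ge0 => i _; exact: sqr_ge0.
Qed.

End Bilinear.

Lemma hs_mull m n k (A : 'M[R[i]]_(m, n)) (B : 'M[R[i]]_(n, k)) (D : 'M[R[i]]_(m, k)) :
  hs (A *m B) D = hs B (adj A *m D).
Proof. by rewrite /hs adjM mulmxA. Qed.

Lemma hs_mulr m n k (A : 'M[R[i]]_(m, n)) (B : 'M[R[i]]_(n, k)) (D : 'M[R[i]]_(m, k)) :
  hs (A *m B) D = hs A (D *m adj B).
Proof. by rewrite /hs adjM -mulmxA mxtrace_mulC -mulmxA. Qed.

(** A quadratic polynomial without sign change has no two distinct roots; when
    [c = 0] it is affine, and a large [t] forces [r = 0]. *)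
Lemma discriminant_le (a r c : R) :
  (forall t : R, 0 <= a - 2 * t * r + t ^+ 2 * c) -> 0 <= a -> 0 <= c ->
  r ^+ 2 <= a * c.
Proof.
move=> H a0 c0; have [cp|] := ltP 0 c.
  have := H (r / c).
  have -> : a - 2 * (r / c) * r + (r / c) ^+ 2 * c = (a * c - r ^+ 2) / c.
    by field; rewrite gt_eqF.
  by rewrite pmulr_lge0 ?invr_gt0 // subr_ge0.
move=> c0'; have c00 : c = 0 by apply/eqP; rewrite eq_le c0 c0'.
rewrite c00 mulr0; have [->|r0] := eqVneq r 0; first by rewrite expr0n.
have := H ((a + 1) / (2 * r)); rewrite c00 mulr0 addr0.
have -> : a - 2 * ((a + 1) / (2 * r)) * r = -1 by field.
by rewrite lerNr oppr0 ler10.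
Qed.

Lemma hs_CS m n (A B : 'M[R[i]]_(m, n)) : hs A B ^+ 2 <= hs A A * hs B B.
Proof.
apply: discriminant_le; rewrite ?hs_ge0 // => t.
have := hs_ge0 (A - t%:C *: B).
rewrite !(hsBl, hsBr) !hsZl !hsZr (hsC B A); congr (_ <= _); ring.
Qed.

(** Only the real part of the quadratic form is recorded: it is all that the
    order between the self-adjoint matrices below depends on. *)
Definition qf n (v : 'cV[R[i]]_n) (A : 'M[R[i]]_n) : R := hs v (A *m v).

Definition psd n (A : 'M[R[i]]_n) := forall v, 0 <= qf v A.

Section QuadraticForm.
Variable n : nat.
Implicit Types (v : 'cV[R[i]]_n) (A B : 'M[R[i]]_n).

Lemma qfD v A B : qf v (A + B) = qf v A + qf v B.
Proof. by rewrite /qf mulmxDl hsDr. Qed.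

Lemma qfB v A B : qf v (A - B) = qf v A - qf v B.
Proof. by rewrite /qf mulmxBl hsBr. Qed.

Lemma qfZ v (c : R) A : qf v (c%:C *: A) = c * qf v A.
Proof. by rewrite /qf -scalemxAl hsZr. Qed.

Lemma qf0 v : qf v 0 = 0.
Proof. by rewrite /qf mul0mx hs0r. Qed.

Lemma qf_sum v (I : Type) (r : seq I) (P : pred I) (F : I -> 'M[R[i]]_n) :
  qf v (\sum_(i <- r | P i) F i) = \sum_(i <- r | P i) qf v (F i).
Proof. exact: (big_morph _ (qfD v) (qf0 v)). Qed.

Lemma qf1 v : qf v 1%:M = hs v v.
Proof. by rewrite /qf mul1mx. Qed.

End QuadraticForm.

Lemma qf_conj n k (v : 'cV[R[i]]_n) (B : 'M[R[i]]_(k, n)) (A : 'M[R[i]]_k) :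
  qf v (adj B *m A *m B) = qf (B *m v) A.
Proof. by rewrite /qf hs_mull !mulmxA. Qed.

Lemma qf_gram n k (v : 'cV[R[i]]_n) (A B : 'M[R[i]]_(k, n)) :
  qf v (adj A *m B) = hs (A *m v) (B *m v).
Proof. by rewrite /qf hs_mull mulmxA. Qed.

Lemma psd_gram n k (A : 'M[R[i]]_(k, n)) : psd (adj A *m A).
Proof. by move=> v; rewrite qf_gram hs_ge0. Qed.

(** The columns [(A i *m v)_i] and [(B i *m v)_i] are vectors of one direct sum,
    where this is the Cauchy-Schwarz inequality. *)
Lemma qf_sum_CS n (I : finType) (v : 'cV[R[i]]_n) (A B : I -> 'M[R[i]]_n) :
  (\sum_i qf v (adj (A i) *m B i)) ^+ 2 <=
  (\sum_i qf v (adj (A i) *m A i)) * (\sum_i qf v (adj (B i) *m B i)).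
Proof.
apply: discriminant_le => [t||]; last 2 first.
- by apply: sumr_ge0 => i _; exact: psd_gram.
- by apply: sumr_ge0 => i _; exact: psd_gram.
rewrite !mulr_sumr -sumrB -big_split /=; apply: sumr_ge0 => i _.
rewrite !qf_gram; have := hs_ge0 (A i *m v - t%:C *: (B i *m v)).
rewrite !(hsBl, hsBr) !hsZl !hsZr (hsC (B i *m v)); congr (_ <= _); ring.
Qed.

Definition rtr n (A : 'M[R[i]]_n) : R := complex.Re (\tr A).

Lemma hs_rtr m n (A B : 'M[R[i]]_(m, n)) : hs A B = rtr (adj A *m B).
Proof. by []. Qed.

(** A unitary matrix gives the orthonormal basis of its conjugated rows. *)
Definition uvec n (U : 'M[R[i]]_n) (i : 'I_n) : 'cV[R[i]]_n := adj (row i U).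

Lemma qf_uvec n (U A : 'M[R[i]]_n) i :
  qf (uvec U i) A = complex.Re ((U *m A *m adj U) i i).
Proof.
rewrite /qf /hs /uvec adjK trace_mx11 mulmxA -row_mul !mxE; congr complex.Re.
by apply: eq_bigr => k _; rewrite !mxE.
Qed.

Lemma rtr_uvec n (U A : 'M[R[i]]_n) : U \is unitarymx ->
  rtr A = \sum_i qf (uvec U i) A.
Proof.
move=> /unitarymxP UU; have UU' : adj U *m U = 1%:M by exact: mulmx1C UU.
under eq_bigr do rewrite qf_uvec.
by rewrite -Re_sum -/(\tr _) mxtrace_mulC mulmxA UU' mul1mx.
Qed.

Lemma qf_uvec1 n (U : 'M[R[i]]_n) i : U \is unitarymx -> qf (uvec U i) 1%:M = 1.
Proof. by move=> /unitarymxP UU; rewrite qf_uvec mulmx1 UU mxE eqxx. Qed.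

End HilbertSchmidt.

(** * Functional calculus *)

Section Spectral.
Variable R : realType.

(** The matrix with real eigenvalues [l] in the orthonormal basis [uvec U]. *)
Definition specmx m (U : 'M[R[i]]_m) (l : 'I_m -> R) : 'M[R[i]]_m :=
  adj U *m diag_mx (\row_i (l i)%:C) *m U.

Section Specmx.
Variables (m : nat) (U : 'M[R[i]]_m).
Hypothesis Uu : U \is unitarymx.
Implicit Types l k : 'I_m -> R.

Let UU : U *m adj U = 1%:M. Proof. exact/unitarymxP. Qed.
Let UU' : adj U *m U = 1%:M. Proof. exact: mulmx1C UU. Qed.

Lemma adj_specmx l : adj (specmx U l) = specmx U l.
Proof.
rewrite /specmx !adjM adjK mulmxA; congr (_ *m _ *m _).
apply/matrixP => i j; rewrite adjE !mxE.
have [->|ij] := eqVneq i j; first by rewrite !mulr1n conjc_real.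
by rewrite !mulr0n conjc0.
Qed.

Lemma specmxM l k : specmx U l *m specmx U k = specmx U (fun i => l i * k i).
Proof.
rewrite /specmx !mulmxA -[_ *m U *m adj U]mulmxA UU mulmx1.
congr (_ *m _); rewrite -!mulmxA; congr (_ *m _).
rewrite mulmx_diag; congr diag_mx.
by apply/rowP => i; rewrite !mxE rmorphM.
Qed.

Lemma specmx1 : specmx U (fun=> 1) = 1%:M.
Proof.
rewrite /specmx; have -> : (\row_(i < m) (1 : R)%:C) = const_mx 1.
  by apply/rowP => i; rewrite !mxE.
by rewrite diag_const_mx mulmx1.
Qed.

Lemma specmx_cst (c : R) : specmx U (fun=> c) = c%:C *: 1%:M.
Proof.
rewrite -specmx1 /specmx scalemxAl scalemxAr; congr (_ *m _ *m _).
by apply/matrixP => i j; rewrite !mxE mulrnAr rmorph1 mulr1.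
Qed.

Lemma specmxB l k : specmx U l - specmx U k = specmx U (fun i => l i - k i).
Proof.
rewrite /specmx -mulmxBl -mulmxBr; congr (_ *m _ *m _).
by apply/matrixP => i j; rewrite !mxE -mulrnBl -rmorphB.
Qed.

Lemma qf_uvec_specmx l i : qf (uvec U i) (specmx U l) = l i.
Proof.
rewrite qf_uvec /specmx !mulmxA UU mul1mx -mulmxA UU mulmx1.
by rewrite !mxE eqxx mulr1n.
Qed.

Lemma qf_specmx l v :
  qf v (specmx U l) = \sum_i l i * (complex.Re `|(U *m v) i 0|) ^+ 2.
Proof.
rewrite /specmx qf_conj /qf hsE exchange_big /=; apply: eq_bigr => i _.
rewrite big_ord1 mul_diag_mx !mxE.
set z := \sum_(_ < m) _. case: z => a b.
rewrite /= sqr_sqrtr ?addr_ge0 ?sqr_ge0 //; ring.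
Qed.

Lemma rtr_specmx l : rtr (specmx U l) = \sum_i l i.
Proof. by rewrite (rtr_uvec _ Uu); apply: eq_bigr => i _; rewrite qf_uvec_specmx. Qed.

Lemma ler_qf_specmx l k v : (forall i, l i <= k i) ->
  qf v (specmx U l) <= qf v (specmx U k).
Proof.
by move=> lk; rewrite !qf_specmx; apply: ler_sum => i _; rewrite ler_wpM2r ?sqr_ge0.
Qed.

(** The functional calculus is independent of the diagonalization: if
    [diag s *m W = W *m diag l], then [W i j = 0] unless [s i = l j], so that
    [W] also intertwines [diag (f s)] with [diag (f l)]. *)
Lemma mxfun_specmx (f : R -> R) l :
  mxfun f (specmx U l) = specmx U (fun i => f (l i)).
Proof.
set A := specmx U l; have AA : adj A = A by exact: adj_specmx.
have /orthomx_spectralP An : A \is normalmx.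
  by apply/normalmxP; rewrite -/(adj A) AA.
set P := spectralmx A in An; set sp := spectral_diag A in An.
have Pu : P \in unitmx by exact: spectral_unit.
set W := P *m adj U; have WU : W *m U = P by rewrite /W -mulmxA UU' mulmx1.
have E : diag_mx sp *m W = W *m diag_mx (\row_i (l i)%:C).
  have PA : P *m A = diag_mx sp *m P by rewrite [X in _ *m X]An -mulmxA mulKVmx.
  rewrite /W mulmxA -PA /A /specmx !mulmxA -(mulmxA _ U (adj U)) UU mulmx1.
  by [].
have E' : diag_mx (map_mx (fun z : R[i] => (f (complex.Re z))%:C) sp) *m W =
    W *m diag_mx (\row_i (f (l i))%:C).
  apply/matrixP => i j; move/matrixP/(_ i j): E.
  rewrite !mul_diag_mx !mul_mx_diag !mxE.
  set w := \sum_(_ < m) _.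
  have [->|w0] := eqVneq w 0; first by rewrite !mulr0 !mul0r.
  by rewrite mulrC => /(mulfI w0) ->; rewrite mulrC.
have IW : invmx P *m W = adj U by rewrite /W mulKmx.
rewrite /mxfun -/P -/sp /specmx; move: (diag_mx _) (diag_mx _) E' => D' D E'.
clearbody W P; clear -E' WU IW.
by rewrite -mulmxA -{2}WU (mulmxA D) E' !mulmxA IW.
Qed.

End Specmx.

Lemma spectral_psd m (A : 'M[R[i]]_m) : adj A = A -> psd A ->
  exists (U : 'M[R[i]]_m) (l : 'I_m -> R),
    [/\ U \is unitarymx, forall i, 0 <= l i & A = specmx U l].
Proof.
move=> AA Ap; have An : A \is normalmx by apply/normalmxP; rewrite -/(adj A) AA.
have Ah : A \is hermsymmx.
  by apply/is_hermitianmxP; rewrite expr0 scale1r -/(adj A) AA.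
have Uu := spectral_unitarymx A.
have : A = specmx (spectralmx A) (fun i => complex.Re (spectral_diag A 0 i)).
  have := orthomx_spectralP An; rewrite (invmx_unitary Uu) => E0.
  rewrite [LHS]E0 {E0}.
  congr (_ *m diag_mx _ *m _); apply/rowP => i; rewrite !mxE RRe_real //.
  by have /mxOverP/(_ 0 i) := hermitian_spectral_diag_real Ah.
move: (spectralmx A) (fun i => _) Uu => U l Uu E.
by exists U, l; split=> // i; have := Ap (uvec U i); rewrite {1}E qf_uvec_specmx.
Qed.

End Spectral.

Section Functionals.
Variables (R : realType) (n : nat).
Implicit Types A : qop R n.

Lemma Re_ntrace A : complex.Re (ntrace A) = rtr A / 2 ^+ n.
Proof.
rewrite /ntrace /rtr -[RHS]mulrC -ReZ; congr (complex.Re (_ * _)).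
by rewrite rmorphV ?unitfE ?expf_neq0 // rmorphXn /= rmorph_nat.
Qed.

Definition gradsq A : qop R n := \sum_(j < n) adj (dj j A) *m dj j A.

Lemma psd_gradsq A : psd (gradsq A).
Proof. by move=> v; rewrite qf_sum; apply: sumr_ge0 => j _; exact: psd_gram. Qed.

Lemma absmx_sqr m (A : 'M[R[i]]_m) : absmx A *m absmx A = adj A *m A.
Proof.
have [||U [l [Uu l0 E]]] := @spectral_psd R m (adj A *m A).
- by rewrite adjM adjK.
- exact: psd_gram.
rewrite /absmx -/(adj A) E (mxfun_specmx Uu) (specmxM Uu); congr specmx.
by apply/funext => i; rewrite -expr2 sqr_sqrtr.
Qed.

Lemma absmx_specmx m (U : 'M[R[i]]_m) (l : 'I_m -> R) : U \is unitarymx ->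
  (forall i, 0 <= l i) -> absmx (specmx U l) = specmx U l.
Proof.
move=> Uu l0; rewrite /absmx -/(adj _) adj_specmx (specmxM Uu) (mxfun_specmx Uu).
by congr specmx; apply/funext => i; rewrite -expr2 sqrtr_sqr ger0_norm.
Qed.

Lemma pnorm_powR p A (U : 'M[R[i]]_(qdim n)) (l : 'I_(qdim n) -> R) : p != 0 ->
  U \is unitarymx -> absmx A = specmx U l -> (forall i, 0 <= l i) ->
  pnorm p A `^ p = (\sum_i l i `^ p) / 2 ^+ n.
Proof.
move=> p0 Uu E l0; rewrite /pnorm -powRrM mulVf // E (mxfun_specmx Uu).
rewrite Re_ntrace (rtr_specmx Uu) powRr1 // divr_ge0 ?exprn_ge0 //.
by apply: sumr_ge0 => i _; exact: powR_ge0.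
Qed.

(** The nested functional calculi in [gradmx] and [pnorm] are all diagonal in an
    eigenbasis of [gradsq A], which turns the energy into a scalar sum. No other
    property of [energy] enters the estimates. *)
Lemma energyE p A : p != 0 -> exists2 U : 'M[R[i]]_(qdim n), U \is unitarymx &
  energy p A = (\sum_i Num.sqrt (qf (uvec U i) (gradsq A)) `^ p) / 2 ^+ n.
Proof.
move=> p0; have [||U [l [Uu l0 E]]] := @spectral_psd R _ (gradsq A).
- by rewrite adj_sum; apply: eq_bigr => j _; rewrite adjM adjK.
- exact: psd_gradsq.
exists U => //; have G : gradmx A = specmx U (fun i => Num.sqrt (l i)).
  rewrite /gradmx (eq_bigr (fun j => adj (dj j A) *m dj j A)) => [|j _]; last first.
    exact: absmx_sqr.
  by rewrite -/(gradsq A) E (mxfun_specmx Uu).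
rewrite /energy G (@pnorm_powR p _ U (fun i => Num.sqrt (l i)) p0 Uu).
- by congr (_ / _); apply: eq_bigr => i _; rewrite E (qf_uvec_specmx Uu).
- by apply: (absmx_specmx Uu) => i; exact: sqrtr_ge0.
- by move=> i; exact: sqrtr_ge0.
Qed.

Lemma energy_ge0 p A : 0 <= energy p A.
Proof. exact: powR_ge0. Qed.

Lemma qvarE A :
  qvar A = hs (A - (ntrace A)%:M) (A - (ntrace A)%:M) / 2 ^+ n.
Proof.
rewrite /qvar; set B := A - _.
have [||U [l [Uu l0 E]]] := @spectral_psd R _ (adj B *m B).
- by rewrite adjM adjK.
- exact: psd_gram.
rewrite -powR_mulrn; last exact: powR_ge0.
have -> := @pnorm_powR 2%:R B U (fun i => Num.sqrt (l i)).
- rewrite hs_rtr E (rtr_specmx Uu); congr (_ / _); apply: eq_bigr => i _.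
  by rewrite powR_mulrn ?sqrtr_ge0 // sqr_sqrtr.
- by rewrite pnatr_eq0.
- exact: Uu.
- by rewrite /absmx -/(adj B) E mxfun_specmx.
- by move=> i; exact: sqrtr_ge0.
Qed.

Lemma l2norm_hs m (v : 'cV[R[i]]_m) : l2norm v = Num.sqrt (hs v v).
Proof. by rewrite /l2norm hs_norm2 big_ord1. Qed.

End Functionals.

(** * Matrix units and partial traces *)

Section SetBit.
Variable n : nat.
Implicit Types (x : bitstr n) (i j : 'I_n) (a b : 'I_2).

Lemma setbitE x j b : setbit x j b j = b.
Proof. by rewrite ffunE eqxx. Qed.

Lemma setbit_neq x i j b : i != j -> setbit x i b j = x j.
Proof. by rewrite ffunE eq_sym => /negbTE ->. Qed.

Lemma setbit_id x j : setbit x j (x j) = x.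
Proof. by apply/ffunP => k; rewrite ffunE; case: eqP => [->|]. Qed.

Lemma setbitK x j a b : setbit (setbit x j a) j b = setbit x j b.
Proof. by apply/ffunP => k; rewrite !ffunE; case: eqP. Qed.

Lemma setbitC x i j a b : i != j ->
  setbit (setbit x i a) j b = setbit (setbit x j b) i a.
Proof.
move=> ij; apply/ffunP => k; rewrite !ffunE.
by case: (eqVneq k j) => [->|//]; rewrite eq_sym (negbTE ij).
Qed.

Lemma eq_setbit x y j a b :
  (x j == a) && (y == setbit x j b) = (y j == b) && (x == setbit y j a).
Proof.
apply/andP/andP => -[/eqP <- /eqP ->].
  by rewrite setbitE setbitK setbit_id !eqxx.
by rewrite setbitE setbitK setbit_id !eqxx.
Qed.

Lemma bitsK (a : 'I_(qdim n)) : unbits (bits a) = a.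
Proof. exact: enum_valK. Qed.

Lemma unbitsK x : bits (unbits x) = x.
Proof. exact: enum_rankK. Qed.

Lemma bits_inj : injective (@bits n).
Proof. exact: enum_val_inj. Qed.

End SetBit.

Section MatrixUnits.
Variables (R : realType) (n : nat).
Implicit Types (A B : qop R n) (i j : 'I_n) (a b c d s t : 'I_2).

(** The matrix unit |a><b| acting on the j-th tensor factor. *)
Definition munit j a b : qop R n :=
  \matrix_(x, y) ((bits x j == a) && (bits y == setbit (bits x) j b))%:R.

Lemma munit_mull j a b A x y :
  (munit j a b *m A) x y
  = (bits x j == a)%:R * A (unbits (setbit (bits x) j b)) y.
Proof.
rewrite mxE (bigD1 (unbits (setbit (bits x) j b))) //= big1 ?addr0.
  by rewrite mxE unbitsK eqxx andbT.
move=> z zx; rewrite mxE; case: (bits z =P _) => [E|]; last by rewrite andbF mul0r.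
by rewrite -E bitsK eqxx in zx.
Qed.

Lemma munit_mulr j a b A x y :
  (A *m munit j a b) x y
  = (bits y j == b)%:R * A x (unbits (setbit (bits y) j a)).
Proof.
rewrite mxE (bigD1 (unbits (setbit (bits y) j a))) //= big1 ?addr0.
  by rewrite mxE eq_setbit unbitsK eqxx andbT mulrC.
move=> z zx; rewrite mxE eq_setbit.
case: (bits z =P _) => [E|]; last by rewrite andbF mulr0.
by rewrite -E bitsK eqxx in zx.
Qed.

Lemma munitM j a b c d :
  munit j a b *m munit j c d = (b == c)%:R *: munit j a d.
Proof.
apply/matrixP => x y; rewrite munit_mull !mxE unbitsK setbitE setbitK.
by case: (_ == a) (b == c) (_ == setbit _ _ _) => [] [] []; rewrite /= ?mulr0 ?mul0r ?mul1r.
Qed.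

Lemma munitC i j a b c d : i != j ->
  munit i a b *m munit j c d = munit j c d *m munit i a b.
Proof.
move=> ij; apply/matrixP => x y; rewrite !munit_mull !mxE !unbitsK.
rewrite setbit_neq // setbit_neq 1?eq_sym // setbitC // -!natrM !mulnb.
by congr (nat_of_bool _)%:R; rewrite andbCA.
Qed.

Lemma sum_munit j : \sum_a munit j a a = 1%:M.
Proof.
apply/matrixP => x y; rewrite summxE (bigD1 (bits x j)) //= big1 => [|a ax].
  by rewrite !mxE eqxx setbit_id addr0 eq_sym (inj_eq (@bits_inj n)).
by rewrite mxE eq_sym (negbTE ax).
Qed.

Lemma adj_munit j a b : adj (munit j a b) = munit j b a.
Proof. by apply/matrixP => x y; rewrite adjE !mxE eq_setbit conjc_nat. Qed.

(** The Kraus form of the partial trace; its algebra is that of the matrix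
    units. *)
Lemma taujE j A : tauj j A =
  2^-1 *: \sum_c \sum_s munit j c s *m A *m munit j s c.
Proof.
apply/matrixP => x y; rewrite [LHS]mxE [RHS]mxE summxE.
under [in RHS]eq_bigr => c _ do
  (rewrite summxE; under eq_bigr => s _ do rewrite munit_mulr munit_mull).
rewrite [in RHS](bigD1 (bits x j)) //= [X in _ + X]big1 ?addr0 => [|c cx]; last first.
  by apply: big1 => s _; rewrite [_ == c]eq_sym [bits x j == c]eq_sym (negbTE cx) mul0r mulr0.
rewrite eqxx eq_sym; case: eqP => _.
  by congr (_ * _); apply: eq_bigr => s _; rewrite !mul1r.
by rewrite big1 ?mulr0 // => s _; rewrite mul0r.
Qed.

Lemma taujD j A B : tauj j (A + B) = tauj j A + tauj j B.
Proof. by have := tauj_is_linear j 1 A B; rewrite !scale1r. Qed.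

Lemma tauj0 j : tauj j (0 : qop R n) = 0.
Proof.
by have := tauj_is_linear j (-1) (0 : qop R n) 0; rewrite scaler0 addr0 scaleN1r addNr.
Qed.

Lemma taujZ j (c : R[i]) A : tauj j (c *: A) = c *: tauj j A.
Proof. by have := tauj_is_linear j c A 0; rewrite tauj0 !addr0. Qed.

Lemma taujB j A B : tauj j (A - B) = tauj j A - tauj j B.
Proof. by rewrite -scaleN1r taujD taujZ scaleN1r. Qed.

(** The range of [tauj j] commutes with the j-th tensor factor. That [tauj j] is
    a conditional expectation (a bimodule map over its range) follows. *)
Lemma munit_tauj j a b A :
  munit j a b *m tauj j A = tauj j A *m munit j a b.
Proof.
rewrite taujE -scalemxAr -scalemxAl mulmx_sumr mulmx_suml; congr (_ *: _).
rewrite (bigD1 b) //= [X in _ + X = _]big1 ?addr0 => [|c cb]; last first.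
  rewrite mulmx_sumr big1 // => s _.
  by rewrite !mulmxA munitM eq_sym (negbTE cb) scale0r !mul0mx.
rewrite [in RHS](bigD1 a) //= [X in _ = _ + X]big1 ?addr0 => [|c cb]; last first.
  rewrite mulmx_suml big1 // => s _.
  by rewrite -!mulmxA munitM (negbTE cb) scale0r !mulmx0.
rewrite mulmx_sumr mulmx_suml; apply: eq_bigr => s _.
by rewrite !mulmxA munitM -!mulmxA munitM !eqxx !scale1r.
Qed.

Lemma tauj_mull j A B : tauj j (tauj j A *m B) = tauj j A *m tauj j B.
Proof.
rewrite [LHS]taujE [tauj j B]taujE -scalemxAr mulmx_sumr; congr (_ *: _).
apply: eq_bigr => c _; rewrite mulmx_sumr; apply: eq_bigr => s _.
by rewrite !mulmxA munit_tauj.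
Qed.

Lemma tauj_mulr j A B : tauj j (B *m tauj j A) = tauj j B *m tauj j A.
Proof.
rewrite [LHS]taujE [tauj j B]taujE -scalemxAl mulmx_suml; congr (_ *: _).
apply: eq_bigr => c _; rewrite mulmx_suml; apply: eq_bigr => s _.
by rewrite -!mulmxA -munit_tauj.
Qed.

Lemma tauj1 j : tauj j (1%:M : qop R n) = 1%:M.
Proof.
rewrite taujE; under eq_bigr => c _ do under eq_bigr => s _
  do rewrite mulmx1 munitM eqxx scale1r.
under eq_bigr => c _ do rewrite sumr_const card_ord.
by rewrite sumrMnl sum_munit -[1%:M *+ 2]scaler_nat scalerA mulVf ?scale1r ?pnatr_eq0.
Qed.

Lemma tauj_idem j A : tauj j (tauj j A) = tauj j A.
Proof. by rewrite -[X in tauj j X]mulmx1 tauj_mull tauj1 mulmx1. Qed.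

Lemma taujC i j A : tauj i (tauj j A) = tauj j (tauj i A).
Proof.
have [->//|ij] := eqVneq i j.
rewrite (taujE j A) (taujE i A) !taujZ !(taujE _ (\sum_c _)) !scalerA mulrC.
congr (_ *: _).
under eq_bigr => c _.
  under eq_bigr => s _.
    rewrite mulmx_sumr mulmx_suml.
    under eq_bigr => d _ do rewrite mulmx_sumr mulmx_suml.
    over.
  rewrite exchange_big /=; under eq_bigr => d _ do rewrite exchange_big /=.
  over.
rewrite exchange_big /=; apply: eq_bigr => d _; rewrite exchange_big /=.
under [RHS]eq_bigr => t _.
  rewrite mulmx_sumr mulmx_suml.
  under eq_bigr => c _ do rewrite mulmx_sumr mulmx_suml.
  over.
rewrite [LHS](eq_bigr (fun t => \sum_c \sum_s
   munit j d t *m (munit i c s *m A *m munit i s c) *m munit j t d)) //.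
move=> t _; apply: eq_bigr => c _; apply: eq_bigr => s _.
rewrite !mulmxA munitC // -!mulmxA; congr (_ *m (_ *m _)).
by rewrite munitC 1?eq_sym.
Qed.

Lemma inv2C : 2^-1 = (2^-1 : R)%:C.
Proof. by rewrite fmorphV rmorph_nat. Qed.

Lemma tauj_adj j A : tauj j (adj A) = adj (tauj j A).
Proof.
rewrite !taujE inv2C adjZ adj_sum; congr (_ *: _); apply: eq_bigr => c _.
rewrite adj_sum; apply: eq_bigr => s _.
by rewrite !adjM !adj_munit mulmxA.
Qed.

Lemma hs_tauj j A B : hs (tauj j A) B = hs A (tauj j B).
Proof.
rewrite !taujE inv2C hsZr hsZl; congr (_ * _); rewrite hsC !hs_sumr.
under eq_bigr => c _ do rewrite hs_sumr.
rewrite exchange_big /=; apply: eq_bigr => c _; rewrite hs_sumr; apply: eq_bigr => s _.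
by rewrite hsC -[X in hs X _]mulmxA hs_mull hs_mulr !adj_munit.
Qed.

Lemma qf_tauj j v A : qf v (tauj j A) =
  2^-1 * \sum_c \sum_s qf (munit j s c *m v) A.
Proof.
rewrite taujE inv2C qfZ qf_sum; congr (_ * _); apply: eq_bigr => c _.
rewrite qf_sum; apply: eq_bigr => s _.
by rewrite -(adj_munit j s c) qf_conj.
Qed.

Lemma psd_tauj j A : psd A -> psd (tauj j A).
Proof.
move=> Ap v; rewrite qf_tauj mulr_ge0 ?invr_ge0 //.
by apply: sumr_ge0 => c _; apply: sumr_ge0 => s _.
Qed.

End MatrixUnits.

(** * Depolarizing noise and the reverse Poincare inequality *)

Section Derivation.
Variables (R : realType) (n : nat).
Implicit Types (A B h : qop R n) (i j : 'I_n) (r : R) (s : seq 'I_n).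

Lemma djD j A B : dj j (A + B) = dj j A + dj j B.
Proof. by rewrite /dj taujD opprD addrACA. Qed.

Lemma djZ j (c : R[i]) A : dj j (c *: A) = c *: dj j A.
Proof. by rewrite /dj taujZ scalerBr. Qed.

Lemma tauj_dj j A : tauj j (dj j A) = 0.
Proof. by rewrite /dj taujB tauj_idem subrr. Qed.

Lemma dj_tauj j A : dj j (tauj j A) = 0.
Proof. by rewrite /dj tauj_idem subrr. Qed.

Lemma dj_idem j A : dj j (dj j A) = dj j A.
Proof. by rewrite {1}/dj tauj_dj subr0. Qed.

Lemma tauj_djC i j A : tauj i (dj j A) = dj j (tauj i A).
Proof. by rewrite /dj taujB taujC. Qed.

Lemma tauj_dj_split j A : A = tauj j A + dj j A.
Proof. by rewrite addrC subrK. Qed.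

Lemma hs_dj j A B : hs (dj j A) B = hs A (dj j B).
Proof. by rewrite /dj hsBl hsBr hs_tauj. Qed.

End Derivation.

(** One-site depolarizing noise; [r] is the correlation that is kept. It is locked
    because unification would otherwise unfold it down to matrix entries. *)
HB.lock Definition depol (R : realType) (n : nat) (r : R) (j : 'I_n)
    (A : qop R n) : qop R n := tauj j A + r%:C *: dj j A.

Section Noise.
Variables (R : realType) (n : nat).
Implicit Types (A B h : qop R n) (i j : 'I_n) (r : R) (s : seq 'I_n).

Lemma depolE r j A : depol r j A = tauj j A + r%:C *: dj j A.
Proof. by rewrite depol.unlock. Qed.

Lemma depolD r j A B : depol r j (A + B) = depol r j A + depol r j B.
Proof. by rewrite !depolE taujD djD scalerDr addrACA. Qed.

Lemma depolZ r j (c : R[i]) A : depol r j (c *: A) = c *: depol r j A.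
Proof. by rewrite !depolE taujZ djZ [in RHS]scalerDr !scalerA mulrC. Qed.

Lemma depolB r j A B : depol r j (A - B) = depol r j A - depol r j B.
Proof. by rewrite -scaleN1r depolD depolZ scaleN1r. Qed.

Lemma depol0 r j : depol r j 0 = 0.
Proof. by have := depolB r j 0 0; rewrite !subrr. Qed.

Lemma depol_sum r j (I : Type) (t : seq I) (P : pred I) (F : I -> qop R n) :
  depol r j (\sum_(i <- t | P i) F i) = \sum_(i <- t | P i) depol r j (F i).
Proof. exact: (big_morph _ (depolD r j) (depol0 r j)). Qed.

Lemma depol1 r j : depol r j 1%:M = 1%:M.
Proof. by rewrite !depolE /dj tauj1 subrr scaler0 addr0. Qed.

Lemma tauj_depol i r j A : tauj i (depol r j A) = depol r j (tauj i A).
Proof. by rewrite !depolE taujD taujZ taujC tauj_djC. Qed.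

Lemma dj_depol i r j A : dj i (depol r j A) = depol r j (dj i A).
Proof. by rewrite [LHS]/dj tauj_depol -depolB. Qed.

Lemma depolC r i r' j A :
  depol r i (depol r' j A) = depol r' j (depol r i A).
Proof. by rewrite [LHS]depolE tauj_depol dj_depol -depolZ -depolD -depolE. Qed.

Lemma depol_depol r r' j A : depol r j (depol r' j A) = depol (r * r') j A.
Proof.
have E1 : tauj j (depol r' j A) = tauj j A.
  by rewrite tauj_depol !depolE tauj_idem dj_tauj scaler0 addr0.
have E2 : dj j (depol r' j A) = r'%:C *: dj j A.
  by rewrite dj_depol !depolE tauj_dj add0r dj_idem.
by rewrite [LHS]depolE E1 E2 scalerA -rmorphM -depolE.
Qed.

Lemma hs_depol r j A B : hs (depol r j A) B = hs A (depol r j B).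
Proof. by rewrite !depolE hsDl hsDr hsZl hsZr hs_tauj hs_dj. Qed.

Lemma qf_depol r j v A :
  qf v (depol r j A) = (1 - r) * qf v (tauj j A) + r * qf v A.
Proof.
by rewrite depolE qfD qfZ qfB; move: (qf v A) (qf v (tauj j A)) => a b; ring.
Qed.

Lemma psd_depol r j A : 0 <= r <= 1 -> psd A -> psd (depol r j A).
Proof.
move=> /andP[r0 r1] Ap v; rewrite qf_depol addr_ge0 // mulr_ge0 ?subr_ge0 //.
exact: psd_tauj.
Qed.

(** The defect in the Kadison-Schwarz inequality is computed exactly: with
    [h = e + d], [e = tauj j h] and [d = dj j h], the mixed terms cancel. *)
Lemma depol_gram r j v h :
  qf v (depol r j (adj h *m h)) - qf v (adj (depol r j h) *m depol r j h) =
  (1 - r) * (r * qf v (adj (dj j h) *m dj j h)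
             + qf v (tauj j (adj (dj j h) *m dj j h))).
Proof.
rewrite qf_depol !depolE {1 2 3 4}(tauj_dj_split j h).
have := tauj_dj j h; set e := tauj j h => dE.
have eE : tauj j e = e by rewrite /e tauj_idem.
move: (dj j h) dE => d dE; move: e eE => e eE.
have ee : tauj j (adj e *m e) = adj e *m e.
  by rewrite -{2}eE tauj_mulr tauj_adj eE.
have ed : tauj j (adj e *m d) = 0.
  by rewrite -[in X in adj X]eE -tauj_adj tauj_mull dE mulmx0.
have de : tauj j (adj d *m e) = 0.
  by rewrite -[in X in _ *m X]eE tauj_mulr tauj_adj dE adj0 mul0mx.
rewrite !adjD adjZ !(mulmxDl, mulmxDr) -!(scalemxAl, scalemxAr) !taujD ee ed de.
move: (adj e *m e) (adj e *m d) (adj d *m e) (adj d *m d) (tauj j _).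
move=> E1 E2 E3 E4 E5; rewrite !qfD !qfZ qf0.
move: (qf v E1) (qf v E2) (qf v E3) (qf v E4) (qf v E5) => a b c x y; ring.
Qed.

Lemma depol_gram_ge r j v h : 0 <= r <= 1 ->
  qf v (adj (depol r j h) *m depol r j h)
  + r * (1 - r) * qf v (adj (dj j h) *m dj j h)
  <= qf v (depol r j (adj h *m h)).
Proof.
move=> /andP[r0 r1]; rewrite -lerBrDl depol_gram.
have : 0 <= (1 - r) * qf v (tauj j (adj (dj j h) *m dj j h)).
  by rewrite mulr_ge0 ?subr_ge0 //; apply/psd_tauj/psd_gram.
move: (qf _ _) (qf _ _) => a b; lra.
Qed.

Lemma depol_kadison r j v h : 0 <= r <= 1 ->
  qf v (adj (depol r j h) *m depol r j h) <= qf v (depol r j (adj h *m h)).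
Proof.
move=> r01; apply: le_trans (depol_gram_ge j v h r01); rewrite lerDl.
by case/andP: r01 => r0 r1; rewrite !mulr_ge0 ?subr_ge0 //; exact: psd_gram.
Qed.

Lemma hs_depol_le r j h : 0 <= r <= 1 ->
  hs (depol r j h) (depol r j h) <= hs h h.
Proof.
move=> /andP[r0 r1]; rewrite {3 4}(tauj_dj_split j h) !depolE.
have ed : hs (tauj j h) (dj j h) = 0 by rewrite hs_tauj tauj_dj hs0r.
have r2 : 0 <= 1 - r * r by rewrite subr_ge0 mulr_ile1.
move: (tauj j h) (dj j h) ed => e d ed.
rewrite !(hsDl, hsDr) !hsZl !hsZr (hsC d e) ed.
have := mulr_ge0 r2 (hs_ge0 d).
move: (hs e e) (hs d d) => a b; lra.
Qed.

Definition noise r s A : qop R n := foldr (depol r) A s.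

Lemma noiseD r s A B : noise r s (A + B) = noise r s A + noise r s B.
Proof. by elim: s => //= i s ->; rewrite depolD. Qed.

Lemma noiseZ r s (c : R[i]) A : noise r s (c *: A) = c *: noise r s A.
Proof. by elim: s => //= i s ->; rewrite depolZ. Qed.

Lemma noiseB r s A B : noise r s (A - B) = noise r s A - noise r s B.
Proof. by elim: s => //= i s ->; rewrite depolB. Qed.

Lemma noise1 r s : noise r s 1%:M = 1%:M.
Proof. by elim: s => //= i s ->; rewrite depol1. Qed.

Lemma depol_noise r i r' s A :
  depol r i (noise r' s A) = noise r' s (depol r i A).
Proof. by elim: s => //= j s IH; rewrite depolC IH. Qed.

Lemma dj_noise i r s A : dj i (noise r s A) = noise r s (dj i A).
Proof. by elim: s => //= j s IH; rewrite dj_depol IH. Qed.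

Lemma noise_noise r r' s A : noise r s (noise r' s A) = noise (r * r') s A.
Proof.
by elim: s A => //= i s IH A; rewrite -depol_noise IH depol_depol.
Qed.

Lemma hs_noise r s A B : hs (noise r s A) B = hs A (noise r s B).
Proof.
by elim: s A B => //= i s IH A B; rewrite hs_depol IH depol_noise.
Qed.

Lemma psd_noise r s A : 0 <= r <= 1 -> psd A -> psd (noise r s A).
Proof. by move=> r01 Ap; elim: s => //= i s IH; exact: psd_depol. Qed.

Lemma hs_noise_le r s A : 0 <= r <= 1 -> hs (noise r s A) (noise r s A) <= hs A A.
Proof.
move=> r01; elim: s => //= i s IH; apply: le_trans IH; exact: hs_depol_le.
Qed.

Lemma hs_noise_sq r s A : hs A (noise (r * r) s A) = hs (noise r s A) (noise r s A).
Proof. by rewrite hs_noise noise_noise. Qed.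

Lemma hs_noise_ge0 r s A : 0 <= r -> 0 <= hs A (noise r s A).
Proof.
by move=> r0; rewrite -[r]sqr_sqrtr // expr2 hs_noise_sq hs_ge0.
Qed.

Lemma hs_noise_le1 r s A : 0 <= r <= 1 -> hs A (noise r s A) <= hs A A.
Proof.
move=> /andP[r0 r1]; rewrite -[r]sqr_sqrtr // expr2 hs_noise_sq hs_noise_le //.
by rewrite sqrtr_ge0 -sqrtr1 ler_wsqrtr.
Qed.

(** [noise r s] is a positive contraction, hence dominates its square. *)
Lemma hs_noise_contr r s A : 0 <= r <= 1 ->
  hs (noise r s A) (noise r s A) <= hs A (noise r s A).
Proof.
move=> /[dup] r01 /andP[r0 r1]; rewrite -hs_noise_sq.
have rE : r = Num.sqrt r * Num.sqrt r by rewrite -expr2 sqr_sqrtr.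
have -> : r * r = Num.sqrt r * (r * Num.sqrt r) by rewrite {1}rE; ring.
rewrite -[in leLHS]noise_noise -[in leLHS]noise_noise -[in leLHS]hs_noise.
by rewrite [in leRHS]rE hs_noise_sq hs_noise_le1.
Qed.

(** Reverse Poincare inequality: the Kadison-Schwarz defect is bounded below,
    one site at a time, and the lower bounds collected so far are carried
    through the remaining sites by Kadison-Schwarz again. *)
Lemma reverse_poincare r s v h : 0 <= r <= 1 -> uniq s ->
  r * (1 - r) * \sum_(j <- s)
    qf v (adj (noise r (rem j s) (dj j h)) *m noise r (rem j s) (dj j h))
  <= qf v (noise r s (adj h *m h)).
Proof.
move=> r01 us; pose g j s := noise r (rem j s) (dj j h).
pose S s := \sum_(j <- s) adj (g j s) *m g j s.
suff : psd (noise r s (adj h *m h) - adj (noise r s h) *m noise r s h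
            - (r * (1 - r))%:C *: S s).
  move=> /(_ v); rewrite !qfB qfZ qf_sum.
  have := psd_gram (noise r s h) v; rewrite /g.
  by move: (\sum_(j <- s) _) (qf _ _) (qf _ _) => a b c; lra.
elim: s us {v} => [_|i s IH] /=.
  by move=> v; rewrite /S big_nil scaler0 subr0 subrr qf0.
move=> /andP[ins us] v; have {IH} := psd_depol i r01 (IH us) v.
rewrite !depolB depolZ !qfB !qfZ /S big_cons depol_sum qfD !qf_sum.
have gi : g i (i :: s) = dj i (noise r s h) by rewrite /g /= eqxx dj_noise.
have K := depol_gram_ge i v (noise r s h) r01.
have : \sum_(j <- s) qf v (adj (g j (i :: s)) *m g j (i :: s)) <=
       \sum_(j <- s) qf v (depol r i (adj (g j s) *m g j s)).
  rewrite !big_seq; apply: ler_sum => j js.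
  have -> : g j (i :: s) = depol r i (g j s).
    by rewrite /g /=; case: eqP => // ij; rewrite ij js in ins.
  exact: depol_kadison.
rewrite gi; case/andP: r01 => r0 r1.
have : 0 <= r * (1 - r) by rewrite mulr_ge0 ?subr_ge0.
move: K; move: (\sum_(j <- s) _) (\sum_(j <- s) _) => a b.
move: (qf _ _) (qf _ _) (qf _ _) (qf _ _) => x y z w.
nra.
Qed.

Lemma noise_bound r s v h (L : R) : 0 <= r <= 1 ->
  (forall w, qf w (adj h *m h) <= L ^+ 2 * hs w w) ->
  qf v (noise r s (adj h *m h)) <= L ^+ 2 * hs v v.
Proof.
move=> r01 hL; rewrite -qf1 -qfZ -(noise1 r s) -noiseZ -subr_ge0 -qfB -noiseB.
by apply: psd_noise => // w; rewrite qfB qfZ qf1 subr_ge0.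
Qed.

End Noise.

(** * Integration over the noise parameter *)

Section RealInequalities.
Variable R : realType.
Implicit Types (p r b y M K a : R).

(** The Young inequality to be used at each eigenvector. If [b <= y / 4] the
    first term suffices; otherwise [y = y ^ (p - 1) * y ^ (2 - p)] is at most
    [(4 b) ^ (p - 1) * M ^ (2 - p)]. *)
Lemma young_truncated p b y M : 1 <= p <= 2 -> 0 <= b -> 0 <= y <= M ->
  b * y <= y ^+ 2 / 4 + 4 * b `^ p * M `^ (2 - p).
Proof.
move=> /andP[p1 p2] b0 /andP[y0 yM].
have [by4|yb4] := leP b (y / 4).
  have : b * y <= y / 4 * y by rewrite ler_wpM2r.
  have : 0 <= 4 * b `^ p * M `^ (2 - p) by rewrite !mulr_ge0 ?powR_ge0.
  by rewrite expr2; lra.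
have [->|yn0] := eqVneq y 0.
  by rewrite mulr0 expr0n /= mul0r add0r !mulr_ge0 ?powR_ge0.
have yp : 0 < y by rewrite lt_neqAle eq_sym yn0.
have bp : 0 < b by apply: lt_trans yb4; rewrite divr_gt0.
have yE : y = y `^ (p - 1) * y `^ (2 - p).
  rewrite -powRD ?yn0 ?implybT //.
  have -> : p - 1 + (2 - p) = 1 by ring.
  by rewrite powRr1.
have h1 : y `^ (p - 1) <= 4 * b `^ (p - 1).
  apply: (@le_trans _ _ ((4 * b) `^ (p - 1))).
    by apply: ge0_ler_powR; rewrite ?nnegrE; lra.
  by rewrite powRM // ler_wpM2r ?powR_ge0 // ler1_powR //; lra.
have h2 : y `^ (2 - p) <= M `^ (2 - p).
  by apply: ge0_ler_powR; rewrite ?nnegrE; lra.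
have h3 : b * y <= 4 * b `^ p * M `^ (2 - p).
  have -> : b `^ p = b * b `^ (p - 1) by rewrite mulr_powRB1 //; lra.
  have -> : 4 * (b * b `^ (p - 1)) * M `^ (2 - p)
          = b * (4 * b `^ (p - 1) * M `^ (2 - p)) by ring.
  by rewrite ler_wpM2l // {1}yE ler_pM ?powR_ge0.
by have := sqr_ge0 y; lra.
Qed.

(** After multiplication by [r ^ a * (1 - r) ^ a] this is
    [1 <= r ^ a + (1 - r) ^ a], which holds since [r <= r ^ a]. *)
Lemma powR_beta_split a r : 0 <= a <= 1 -> 0 < r < 1 ->
  (r * (1 - r)) `^ (- a) <= r `^ (- a) + (1 - r) `^ (- a).
Proof.
move=> /andP[a0 a1] /andP[r0 r1].
have r1' : 0 < 1 - r by lra.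
rewrite powRM ?(ltW r0) ?(ltW r1') // !powRN.
have x0 : 0 < r `^ a by exact: powR_gt0.
have y0 : 0 < (1 - r) `^ a by exact: powR_gt0.
have h1 : r <= r `^ a by apply: ger1_powR => //; lra.
have h2 : 1 - r <= (1 - r) `^ a by apply: ger1_powR => //; lra.
move: (r `^ a) ((1 - r) `^ a) x0 y0 h1 h2 => x y x0 y0 h1 h2.
have -> : x^-1 + y^-1 = (x + y) * (x^-1 * y^-1) by field; rewrite !gt_eqF.
by rewrite ler_peMl ?mulr_ge0 ?invr_ge0 ?(ltW x0) ?(ltW y0) //; lra.
Qed.

(** The exponent [p / 2 - 1 >= - 1 / 2] is integrable at both ends of the unit
    interval, uniformly in [p]. *)
Lemma integrate_beta_bound (phi dphi : R -> R) K p :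
  1 <= p <= 2 -> 0 <= K -> (forall r, is_derive r 1 phi (dphi r)) ->
  (forall r, 0 < r < 1 ->
     dphi r <= K * (r `^ (p / 2 - 1) + (1 - r) `^ (p / 2 - 1))) ->
  forall r, 0 <= r < 1 -> phi 1 - phi r <= 4 * K * (1 - r) `^ (p / 2).
Proof.
move=> /andP[p1 p2] K0 dP dle.
have cphi r : {for r, continuous phi}.
  by apply/differentiable_continuous/derivable1_diffP; case: (dP r).
(* [S] is an antiderivative of the bound on [dphi]. *)
pose S r : R := K * (2 / p) * (r `^ (p / 2) - (1 - r) `^ (p / 2)).
have p2gt : 0 < p / 2 by lra.
have dS r : 0 < r < 1 ->
    is_derive r 1 (fun r => phi r - S r)
      (dphi r - K * (r `^ (p / 2 - 1) + (1 - r) `^ (p / 2 - 1))).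
  move=> /andP[r0 r1]; have r1' : 0 < 1 - r by lra.
  have D1 := is_derive1_powR (p / 2) r0.
  have D2 := is_derive1_powR (p / 2) r1'.
  have D3 : is_derive r 1 (fun r : R => 1 - r) (-1).
    by apply: is_derive_eq; rewrite add0r mul1r.
  have D4 := @is_derive1_comp _ (@powR R ^~ (p / 2)) (fun r => 1 - r) r _ _ D2 D3.
  have D5 := is_deriveB D1 D4.
  have D6 := is_deriveZ (K * (2 / p)) D5.
  have D7 := is_deriveB (dP r) D6.
  apply: (is_derive_eq D7).
  rewrite /GRing.scale /=; congr (_ - _).
  by field; lra.
have step (x y : R) : 0 < x -> x < y -> y < 1 -> phi y - phi x <= S y - S x.
  move=> x0 xy y1.
  have [||c] := @MVT_segment R (fun r => phi r - S r)
    (fun r => dphi r - K * (r `^ (p / 2 - 1) + (1 - r) `^ (p / 2 - 1))) x y (ltW xy).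
  - by move=> z; rewrite in_itv /= => /andP[xz zy]; apply: dS; lra.
  - apply: continuous_in_subspaceT => z; rewrite inE /= in_itv /= => /andP[xz zy].
    have zz : 0 < z < 1 by lra.
    by apply/differentiable_continuous/derivable1_diffP; case: (dS z zz).
  rewrite in_itv /= => /andP[xc cy] E.
  have cc : 0 < c < 1 by lra.
  have : (dphi c - K * (c `^ (p / 2 - 1) + (1 - c) `^ (p / 2 - 1))) * (y - x) <= 0.
    by rewrite mulr_le0_ge0 ?subr_le0 ?dle // subr_ge0 ltW.
  by rewrite -E; lra.
have Sle (x y : R) : 0 < x -> x < y -> y < 1 -> S y - S x <= 4 * K * (1 - x) `^ (p / 2).
  move=> x0 xy y1.
  have h1 : y `^ (p / 2) <= 1.
    by rewrite -[leRHS](powRr0 y) ger_powR //; [apply/andP; split|]; lra.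
  have h2 : x <= x `^ (p / 2).
    by apply: ger1_powR; [apply/andP; split|]; lra.
  have h3 : 1 - x <= (1 - x) `^ (p / 2).
    by apply: ger1_powR; [apply/andP; split|]; lra.
  have h4 : 0 <= (1 - y) `^ (p / 2) by exact: powR_ge0.
  have p2' : 0 <= K * (2 / p) <= 2 * K.
    rewrite mulr_ge0 ?divr_ge0 //=; last lra.
    rewrite mulrC ler_wpM2r // ler_pdivrMr; lra.
  rewrite /S; move: (K * (2 / p)) p2' => q /andP[q0 q2].
  move: (x `^ _) (y `^ _) ((1 - x) `^ _) ((1 - y) `^ _) h1 h2 h3 h4 => a b c d h1 h2 h3 h4.
  have : q * (b - d) - q * (a - c) <= q * (2 * c).
    by rewrite -mulrBr ler_wpM2l //; lra.
  have : q * (2 * c) <= 2 * K * (2 * c) by rewrite ler_wpM2r //; lra.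
  lra.
(* The end points, where [S] need not be differentiable, are reached by
   continuity of [phi]. *)
move=> r /andP[r0 r1].
have key x : r < x -> x < 1 -> phi 1 - phi x <= 4 * K * (1 - r) `^ (p / 2).
  move=> rx x1; rewrite lerBlDr.
  apply: (cvgr_to_le (f := phi) (F := at_left 1)).
    exact/cvg_at_left_filter/cphi.
  near=> y; have xy : x < y by near: y; exact: nbhs_left_gt.
  have y1 : y < 1 by near: y; exact: nbhs_left_lt.
  have x0 : 0 < x by lra.
  rewrite -lerBlDr; apply: le_trans (step x y x0 xy y1) _.
  apply: le_trans (Sle x y x0 xy y1) _.
  rewrite ler_wpM2l ?mulr_ge0 //.
  by apply: ge0_ler_powR; rewrite ?nnegrE; lra.
rewrite lerBlDl -lerBlDr.
apply: (cvgr_to_ge (f := phi) (F := at_right r)).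
  exact/cvg_at_right_filter/cphi.
near=> x; have rx : r < x by near: x; exact: nbhs_right_gt.
have x1 : x < 1 by near: x; exact: nbhs_right_lt.
by have := key x rx x1; lra.
Unshelve. all: by end_near. Qed.

End RealInequalities.

(** * Variance lost under noise *)

Section GradientEstimate.
Variables (R : realType) (n : nat).
Implicit Types (f h : qop R n) (j : 'I_n) (r p L : R) (s : seq 'I_n).

Lemma hs_depol_affine r i f h :
  hs f (depol r i h) = hs (tauj i f) h + r * hs (dj i f) h.
Proof. by rewrite depolE hsDr hsZr hs_tauj hs_dj. Qed.

(** Self-adjointness moves the one-site noise at the head of [s] onto [f], where
    it is affine in [r]. *)
Lemma is_derive_noise f h s r : uniq s ->
  is_derive r 1 (fun r => hs f (noise r s h))
    (\sum_(j <- s) hs f (noise r (rem j s) (dj j h))).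
Proof.
elim: s f => [|i s IH] f /=.
  by move=> _; rewrite big_nil; exact: is_derive_cst.
move=> /andP[ins us].
have -> : (fun r => hs f (depol r i (noise r s h))) =
    (fun r => hs (tauj i f) (noise r s h)) +
    (fun r => r) * (fun r => hs (dj i f) (noise r s h)).
  by apply/funext => t; rewrite hs_depol_affine.
have D1 := IH (tauj i f) us; have D2 := IH (dj i f) us.
have D3 := is_deriveM (is_derive_id r 1) D2.
apply: (is_derive_eq (is_deriveD D1 D3)).
rewrite big_cons eqxx /GRing.scale /= mulr1 hs_dj dj_noise addrA addrC; congr (_ + _).
rewrite mulr_sumr -big_split /= !big_seq; apply: eq_bigr => j js.
have /negbTE -> : i != j by apply: contraNneq ins => ->.
by rewrite hs_depol_affine.
Qed.

Definition qnoise r h : qop R n := noise r (enum 'I_n) h.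

(** The gradient of [qnoise r h], divided by [r]. *)
Definition qgrad r h j : qop R n := noise r (rem j (enum 'I_n)) (dj j h).

Lemma dj_qgrad r h j : dj j (qgrad r h j) = qgrad r h j.
Proof. by rewrite /qgrad dj_noise dj_idem. Qed.

Lemma is_derive_qnoise f h r :
  is_derive r 1 (fun r => hs f (qnoise r h)) (\sum_j hs f (qgrad r h j)).
Proof.
have := is_derive_noise f h r (enum_uniq 'I_n).
by rewrite big_enum.
Qed.

Lemma qnoise1 h : qnoise 1 h = h.
Proof.
rewrite /qnoise; elim: (enum _) => //= i s ->.
by rewrite depolE scale1r /dj addrC subrK.
Qed.

Lemma qgrad_energy r h : 0 <= r <= 1 ->
  \sum_j hs (qgrad r h j) (qgrad r h j) <= \sum_j hs h (qgrad r h j).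
Proof.
move=> r01; apply: ler_sum => j _.
apply: le_trans (hs_noise_contr _ _ r01) _.
by rewrite hs_dj -/(qgrad r h j) dj_qgrad.
Qed.

(** The operator inequality [h^* h <= L ^ 2], that is, [L] bounds the operator
    norm of [h]. *)
Definition opbound L h := forall w, qf w (adj h *m h) <= L ^+ 2 * hs w w.

Lemma qgrad_bound r h L v : 0 < r < 1 -> opbound L h -> hs v v = 1 ->
  \sum_j qf v (adj (qgrad r h j) *m qgrad r h j) <= L ^+ 2 / (r * (1 - r)).
Proof.
move=> /andP[r0 r1] hL v1; have r01 : 0 <= r <= 1 by rewrite !ltW.
rewrite ler_pdivlMr; last by rewrite mulr_gt0 // subr_gt0.
have := reverse_poincare v h r01 (enum_uniq 'I_n).
have := noise_bound (enum 'I_n) v r01 hL.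
rewrite big_enum v1 mulr1 mulrC => a b; exact: le_trans b a.
Qed.

(** In an orthonormal eigenbasis of [gradsq f] the pairing of the two gradients
    is at most the sum of the products of their lengths [b i] and [y i], where
    [\sum_i b i ^ p] is the energy of [f] up to normalization, and the reverse
    Poincare inequality bounds the [y i] uniformly. Young's inequality then
    trades part of the product for the squares of the [y i], whose sum is at
    most the derivative of [hs h (qnoise r h)]. *)
Lemma gradient_pairing p f h r L : 1 <= p <= 2 -> 0 < L -> opbound L h ->
  0 < r < 1 ->
  \sum_j hs f (qgrad r h j) <=
    4^-1 * \sum_j hs h (qgrad r h j) +
    4 * (2 ^+ n * energy p f) * L `^ (2 - p)
      * (r `^ (p / 2 - 1) + (1 - r) `^ (p / 2 - 1)).
Proof.
move=> p12 L0 hL r01; have /andP[p1 p2] := p12; have /andP[r0 r1] := r01.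
have r01' : 0 <= r <= 1 by rewrite !ltW.
have [|U Uu ->] := @energyE R n p f; first by rewrite gt_eqF //; lra.
rewrite [2 ^+ n * _]mulrC divfK ?expf_neq0 //.
set e := uvec U; pose b i := Num.sqrt (qf (e i) (gradsq f)).
pose c2 i := \sum_j qf (e i) (adj (qgrad r h j) *m qgrad r h j).
pose M := Num.sqrt (L ^+ 2 / (r * (1 - r))).
have e1 i : hs (e i) (e i) = 1 by rewrite -qf1 qf_uvec1.
have c0 i : 0 <= c2 i by apply: sumr_ge0 => j _; exact: psd_gram.
have cM i : Num.sqrt (c2 i) <= M by apply/ler_wsqrtr/qgrad_bound.
have ME : M `^ (2 - p) <=
    L `^ (2 - p) * (r `^ (p / 2 - 1) + (1 - r) `^ (p / 2 - 1)).
  have rr : 0 <= r * (1 - r) by rewrite mulr_ge0 ?subr_ge0 // ltW.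
  rewrite /M -powR12_sqrt ?divr_ge0 ?sqr_ge0 // -powRrM.
  rewrite powRM ?sqr_ge0 ?invr_ge0 // -powR_mulrn ?(ltW L0) // -powRrM.
  rewrite -[(r * (1 - r))^-1]powR_inv1 // -powRrM.
  have -> : 2%:R * (2^-1 * (2 - p)) = 2 - p by field.
  have -> : -1 * (2^-1 * (2 - p)) = - (1 - p / 2) by field.
  rewrite ler_wpM2l ?powR_ge0 //.
  have -> : p / 2 - 1 = - (1 - p / 2) by ring.
  by apply: powR_beta_split => //; apply/andP; split; lra.
have -> : \sum_j hs f (qgrad r h j) =
    \sum_i \sum_j qf (e i) (adj (dj j f) *m qgrad r h j).
  rewrite exchange_big; apply: eq_bigr => j _.
  by rewrite -rtr_uvec // -hs_rtr hs_dj dj_qgrad.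
have CS i : \sum_j qf (e i) (adj (dj j f) *m qgrad r h j) <= b i * Num.sqrt (c2 i).
  apply: (@le_trans _ _ `|\sum_j qf (e i) (adj (dj j f) *m qgrad r h j)|).
    exact: ler_norm.
  rewrite -sqrtr_sqr /b -sqrtrM; last exact: psd_gradsq.
  apply: ler_wsqrtr; rewrite /gradsq qf_sum; exact: qf_sum_CS.
have Y i : \sum_j qf (e i) (adj (dj j f) *m qgrad r h j) <=
    4^-1 * c2 i + 4 * M `^ (2 - p) * b i `^ p.
  apply: le_trans (CS i) _.
  have := @young_truncated R p (b i) (Num.sqrt (c2 i)) M p12 (sqrtr_ge0 _).
  rewrite sqr_sqrtr // sqrtr_ge0 cM => /(_ isT) /le_trans; apply.
  by rewrite mulrC mulrAC.
apply: le_trans (ler_sum _ (fun i _ => Y i)) _.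
rewrite big_split -!mulr_sumr /=; apply: lerD.
  rewrite ler_wpM2l ?invr_ge0 //; apply: le_trans (qgrad_energy h r01').
  rewrite /c2 exchange_big /= le_eqVlt; apply/orP; left; apply/eqP.
  by apply: eq_bigr => j _; rewrite -rtr_uvec // -hs_rtr.
have S0 : 0 <= \sum_i b i `^ p by apply: sumr_ge0 => i _; exact: powR_ge0.
have -> : forall S l B : R, 4 * S * l * B = 4 * (l * B) * S.
  by move=> S l B; ring.
by rewrite ler_wpM2r // ler_wpM2l.
Qed.

(** The pairing of [f] with [h - qnoise r h] is the integral of the pairing of
    their gradients over the noise parameter. The quadratic terms integrate to a
    fraction of [hs h (h - qnoise r h)], the others to the power
    [(1 - r) ^ (p / 2)]. For [r = 0] this is a Poincare inequality. *)
Theorem short_time_variance p f h r L : 1 <= p <= 2 -> 0 < L -> opbound L h ->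
  0 <= r < 1 ->
  hs f (h - qnoise r h) <= 4^-1 * hs h (h - qnoise r h) +
    16 * (2 ^+ n * energy p f) * L `^ (2 - p) * (1 - r) `^ (p / 2).
Proof.
move=> p12 L0 hL r01.
pose K := 4 * (2 ^+ n * energy p f) * L `^ (2 - p).
have K0 : 0 <= K by rewrite !mulr_ge0 ?energy_ge0 ?powR_ge0 ?exprn_ge0.
pose phi t := hs f (qnoise t h) - 4^-1 * hs h (qnoise t h).
pose dphi t := \sum_j hs f (qgrad t h j) - 4^-1 * \sum_j hs h (qgrad t h j).
have dP (t : R) : is_derive t 1 phi (dphi t).
  exact: is_deriveB (is_derive_qnoise f h t) (is_deriveZ _ (is_derive_qnoise h h t)).
have dle (t : R) : 0 < t < 1 ->
    dphi t <= K * (t `^ (p / 2 - 1) + (1 - t) `^ (p / 2 - 1)).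
  by move=> t01; rewrite lerBlDl; exact: gradient_pairing.
have := integrate_beta_bound p12 K0 dP dle r01.
rewrite /phi qnoise1 !hsBr /K.
move: (hs f h) (hs f _) (hs h h) (hs h _) (energy p f) (L `^ _) ((1 - r) `^ _).
by move=> x1 x2 x3 x4 x5 x6 x7; lra.
Qed.

End GradientEstimate.

(** * Tensorization of trilinear forms *)

Section Tensorization.
Variables (R : realType) (X : finType).

Definition fcons n (a : X) (u : {ffun 'I_n -> X}) : {ffun 'I_n.+1 -> X} :=
  [ffun i => oapp u a (unlift ord0 i)].

Lemma fcons0 n a (u : {ffun 'I_n -> X}) : fcons a u ord0 = a.
Proof. by rewrite ffunE unlift_none. Qed.

Lemma fconsS n a (u : {ffun 'I_n -> X}) i : fcons a u (lift ord0 i) = u i.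
Proof. by rewrite ffunE liftK. Qed.

Lemma big_ffunS n (F : {ffun 'I_n.+1 -> X} -> R) :
  \sum_u F u = \sum_a \sum_u F (fcons a u).
Proof.
rewrite pair_bigA /= (reindex (fun p : X * {ffun 'I_n -> X} => fcons p.1 p.2)) //.
apply: onW_bij.
exists (fun u : {ffun 'I_n.+1 -> X} => (u ord0, [ffun i => u (lift ord0 i)])).
  move=> [a u]; rewrite /= fcons0; congr (_, _).
  by apply/ffunP => i; rewrite ffunE fconsS.
move=> u; apply/ffunP => i; rewrite ffunE.
by case: unliftP => [j ->|->] //=; rewrite ffunE.
Qed.

Lemma big_ffun0 (F : {ffun 'I_0 -> X} -> R) :
  \sum_u F u = F (ffun0 (card_ord 0)).
Proof.
rewrite (big_pred1 (ffun0 (card_ord 0))) // => u /=.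
by apply/esym/eqP/ffunP => -[].
Qed.

Variable K : X -> X -> X -> R.

Definition trilinear n (f g h : {ffun 'I_n -> X} -> R) :=
  \sum_(u : {ffun 'I_n -> X}) \sum_(v : {ffun 'I_n -> X})
    \sum_(w : {ffun 'I_n -> X})
      (\prod_j K (u j) (v j) (w j)) * (f u * g v * h w).

Lemma trilinearS n (f g h : {ffun 'I_n.+1 -> X} -> R) :
  trilinear f g h = \sum_a \sum_b \sum_c K a b c *
    trilinear (fun u => f (fcons a u)) (fun u => g (fcons b u))
              (fun u => h (fcons c u)).
Proof.
rewrite /trilinear big_ffunS; apply: eq_bigr => a _.
under eq_bigr => u _ do rewrite big_ffunS.
rewrite exchange_big; apply: eq_bigr => b _ /=.
under eq_bigr => u _ do under eq_bigr => v _ do rewrite big_ffunS.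
under eq_bigr => u _ do rewrite exchange_big.
rewrite exchange_big; apply: eq_bigr => c _ /=.
rewrite mulr_sumr; apply: eq_bigr => u _.
rewrite mulr_sumr; apply: eq_bigr => v _.
rewrite mulr_sumr; apply: eq_bigr => w _.
rewrite big_ord_recl !fcons0 -mulrA; congr (_ * (_ * _)).
by apply: eq_bigr => j _; rewrite !fconsS.
Qed.

(** Norm bounds of trilinear forms are not multiplicative in general, but they
    are for nonnegative coefficients and vectors: once the first coordinates are
    frozen, the bound for the others replaces each vector by the vector of its
    partial Euclidean norms, to which the one-site bound applies. *)
Lemma trilinear_le (c : R) : 0 <= c -> (forall x y z, 0 <= K x y z) ->
  (forall f g h : X -> R, (forall x, 0 <= f x) -> (forall x, 0 <= g x) ->
     (forall x, 0 <= h x) ->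
     \sum_x \sum_y \sum_z K x y z * (f x * g y * h z) <=
     c * (Num.sqrt (\sum_x f x ^+ 2) * Num.sqrt (\sum_x g x ^+ 2)
          * Num.sqrt (\sum_x h x ^+ 2))) ->
  forall n (f g h : {ffun 'I_n -> X} -> R), (forall u, 0 <= f u) ->
    (forall u, 0 <= g u) -> (forall u, 0 <= h u) ->
    trilinear f g h <=
      c ^+ n * (Num.sqrt (\sum_u f u ^+ 2) * Num.sqrt (\sum_u g u ^+ 2)
                * Num.sqrt (\sum_u h u ^+ 2)).
Proof.
move=> c0 K0 H; elim=> [|n IH] f g h f0 g0 h0.
  rewrite /trilinear !big_ffun0 big_ord0 expr0 !mul1r.
  by rewrite !sqrtr_sqr !ger0_norm.
rewrite trilinearS.
pose S (k : {ffun 'I_n.+1 -> X} -> R) a :=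
  Num.sqrt (\sum_u k (fcons a u) ^+ 2).
apply: (@le_trans _ _
  (\sum_a \sum_b \sum_d K a b d * (c ^+ n * (S f a * S g b * S h d)))).
  apply: ler_sum => a _; apply: ler_sum => b _; apply: ler_sum => d _.
  by rewrite ler_wpM2l // IH.
have E : \sum_a \sum_b \sum_d K a b d * (c ^+ n * (S f a * S g b * S h d)) =
    c ^+ n * \sum_a \sum_b \sum_d K a b d * (S f a * S g b * S h d).
  rewrite mulr_sumr; apply: eq_bigr => a _; rewrite mulr_sumr.
  apply: eq_bigr => b _; rewrite mulr_sumr; apply: eq_bigr => d _.
  by rewrite mulrCA.
rewrite E exprSr -mulrA ler_wpM2l ?exprn_ge0 //.
have sq k : Num.sqrt (\sum_u k u ^+ 2) = Num.sqrt (\sum_a S k a ^+ 2).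
  rewrite big_ffunS; congr Num.sqrt; apply: eq_bigr => a _.
  by rewrite sqr_sqrtr // sumr_ge0 // => u _; exact: sqr_ge0.
by rewrite !sq; apply: H => a; exact: sqrtr_ge0.
Qed.

End Tensorization.

Section OneQubit.
Variable R : realType.
Implicit Types (r : R) (f g h : 'I_2 * 'I_2 -> R).

(** The coefficients of the one-qubit noise on matrix units. *)
Definition depol_kernel r (v w : 'I_2 * 'I_2) : R :=
  (1 - r) / 2 * ((v.1 == v.2) && (w.1 == w.2))%:R + r * (w == v)%:R.

(** The coefficients of the pair [(A, B)] in the entries of [(T A)^T (T B)],
    where [T] is the one-qubit noise. *)
Definition gram_kernel r (u v w : 'I_2 * 'I_2) : R :=
  \sum_z depol_kernel r u (z, w.1) * depol_kernel r v (z, w.2).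

Lemma depol_kernel_ge0 r v w : 0 <= r <= 1 -> 0 <= depol_kernel r v w.
Proof.
move=> /andP[r0 r1]; rewrite addr_ge0 // mulr_ge0 // ?ler0n //; lra.
Qed.

Lemma gram_kernel_ge0 r u v w : 0 <= r <= 1 -> 0 <= gram_kernel r u v w.
Proof.
by move=> r01; apply: sumr_ge0 => z _; rewrite mulr_ge0 ?depol_kernel_ge0.
Qed.

(** The one-qubit case of hypercontractivity: for the matrix [M] with diagonal
    entries [m + d], [m - d] and off-diagonal entries [q], [s], noise multiplies
    [d], [q] and [s] by [r], and the left-hand side is the trace of the square of
    [M M^T] after noise. Below [r = 1 / 4] the expansions in [m ^ 2], [d ^ 2] and
    [q ^ 2 + s ^ 2] can be compared term by term. *)
Lemma qubit_4norm r (m d q s : R) : 0 <= r <= 4^-1 ->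
  ((m + r * d) ^+ 2 + (r * q) ^+ 2) ^+ 2
  + 2 * ((m + r * d) * (r * s) + (r * q) * (m - r * d)) ^+ 2
  + ((r * s) ^+ 2 + (m - r * d) ^+ 2) ^+ 2
  <= 2^-1 * ((m + d) ^+ 2 + q ^+ 2 + s ^+ 2 + (m - d) ^+ 2) ^+ 2.
Proof.
move=> /andP[r0 r4].
have r2 : 0 <= r ^+ 2 <= 16^-1.
  rewrite sqr_ge0 /=; have -> : 16^-1 = 4^-1 ^+ 2 :> R by field.
  by rewrite lerXn2r // nnegrE; lra.
set Q := q ^+ 2 + s ^+ 2.
have Q0 : 0 <= Q by rewrite addr_ge0 ?sqr_ge0.
have h1 : ((m + r * d) ^+ 2 + (r * q) ^+ 2) ^+ 2
    + ((r * s) ^+ 2 + (m - r * d) ^+ 2) ^+ 2 <=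
    2 * (m ^+ 2 + r ^+ 2 * d ^+ 2 + r ^+ 2 * Q / 2) ^+ 2
    + 16 * r ^+ 2 * m ^+ 2 * d ^+ 2 + r ^+ 2 * r ^+ 2 * Q ^+ 2.
  have := sqr_ge0 (4 * r * m * d - r ^+ 2 * (q ^+ 2 - s ^+ 2)).
  have := sqr_ge0 (2 * r ^+ 2 * q * s).
  rewrite /Q; lra.
have h2 : ((m + r * d) * (r * s) + (r * q) * (m - r * d)) ^+ 2 <=
    r ^+ 2 * (4 * m ^+ 2 * Q + 4 * r ^+ 2 * d ^+ 2 * Q).
  have -> : ((m + r * d) * (r * s) + (r * q) * (m - r * d)) ^+ 2 =
      r ^+ 2 * (m * (s + q) + r * d * (s - q)) ^+ 2 by ring.
  rewrite ler_wpM2l ?sqr_ge0 //.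
  have := sqr_ge0 (m * (s + q) - r * d * (s - q)).
  have := sqr_ge0 (m * (s - q)).
  have := sqr_ge0 (r * d * (s + q)).
  rewrite /Q; lra.
have -> : 2^-1 * ((m + d) ^+ 2 + q ^+ 2 + s ^+ 2 + (m - d) ^+ 2) ^+ 2 =
    2 * (m ^+ 2 + d ^+ 2 + Q / 2) ^+ 2 by rewrite /Q; field.
move/andP: r2 => [t0 t1]; move: h1 h2.
set A := ((m + r * d) ^+ 2 + (r * q) ^+ 2) ^+ 2.
set B := ((r * s) ^+ 2 + (m - r * d) ^+ 2) ^+ 2.
set D := ((m + r * d) * (r * s) + (r * q) * (m - r * d)) ^+ 2.
move: A B D (sqr_ge0 m) (sqr_ge0 d) t0 t1.
move: (m ^+ 2) (d ^+ 2) (r ^+ 2) => x y t A B D x0 y0 t0 t1 h1 h2.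
have a0 : 0 <= t * y by rewrite mulr_ge0.
have b0 : 0 <= t * Q by rewrite mulr_ge0.
have ay : 16 * (t * y) <= y.
  have : t * y <= 16^-1 * y by rewrite ler_wpM2r.
  lra.
have bQ : 16 * (t * Q) <= Q.
  have : t * Q <= 16^-1 * Q by rewrite ler_wpM2r.
  lra.
have : (x + 16 * (t * y) + 16 * (t * Q) / 2) ^+ 2 <= (x + y + Q / 2) ^+ 2.
  by rewrite lerXn2r ?nnegrE //; lra.
have xa : 0 <= x * (t * y) by rewrite mulr_ge0.
have xb : 0 <= x * (t * Q) by rewrite mulr_ge0.
have ab : 0 <= (t * y) * (t * Q) by rewrite mulr_ge0.
have aa := sqr_ge0 (t * y); have bb := sqr_ge0 (t * Q).
move: h1 h2.
have -> : 16 * t * x * y = 16 * (x * (t * y)) by ring.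
have -> : t * t * Q ^+ 2 = (t * Q) ^+ 2 by ring.
have -> : t * (4 * x * Q + 4 * t * y * Q) = 4 * (x * (t * Q)) + 4 * ((t * y) * (t * Q)).
  by ring.
move: (t * y) (t * Q) a0 b0 ay bQ xa xb ab aa bb => a b; lra.
Qed.

Lemma sum_CS (I : finType) (a b : I -> R) :
  (\sum_i a i * b i) ^+ 2 <= (\sum_i a i ^+ 2) * (\sum_i b i ^+ 2).
Proof.
apply: discriminant_le => [t||]; try by apply: sumr_ge0 => i _; exact: sqr_ge0.
rewrite !mulr_sumr -sumrB -big_split /=; apply: sumr_ge0 => i _.
have := sqr_ge0 (a i - t * b i); congr (_ <= _); ring.
Qed.

Lemma sum_CS_sqrt (I : finType) (a b : I -> R) :
  \sum_i a i * b i <= Num.sqrt (\sum_i a i ^+ 2) * Num.sqrt (\sum_i b i ^+ 2).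
Proof.
apply: le_trans (ler_norm _) _; rewrite -sqrtr_sqr -sqrtrM.
  by apply: ler_wsqrtr; exact: sum_CS.
by apply: sumr_ge0 => i _; exact: sqr_ge0.
Qed.

Lemma big_ord2 (V : nmodType) (F : 'I_2 -> V) :
  \sum_(i < 2) F i = F ord0 + F ord_max.
Proof.
by rewrite !big_ord_recl big_ord0 addr0; congr (_ + F _); exact/val_inj.
Qed.

Lemma big_pair2 (V : nmodType) (F : 'I_2 * 'I_2 -> V) :
  \sum_v F v = \sum_(x < 2) \sum_(y < 2) F (x, y).
Proof. by rewrite pair_bigA /=; apply: eq_bigr => -[]. Qed.

(** The left-hand side is the square of the Hilbert-Schmidt pairing of [M M^T]
    and [N N^T], the factors on the right are their squared norms. *)
Lemma gram_2x2 (m1 m2 m3 m4 n1 n2 n3 n4 : R) :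
  ((m1 * n1 + m3 * n3) ^+ 2 + (m1 * n2 + m3 * n4) ^+ 2
   + ((m2 * n1 + m4 * n3) ^+ 2 + (m2 * n2 + m4 * n4) ^+ 2)) ^+ 2 <=
  ((m1 ^+ 2 + m2 ^+ 2) ^+ 2 + 2 * (m1 * m3 + m2 * m4) ^+ 2
   + (m3 ^+ 2 + m4 ^+ 2) ^+ 2) *
  ((n1 ^+ 2 + n2 ^+ 2) ^+ 2 + 2 * (n1 * n3 + n2 * n4) ^+ 2
   + (n3 ^+ 2 + n4 ^+ 2) ^+ 2).
Proof.
have -> : (m1 * n1 + m3 * n3) ^+ 2 + (m1 * n2 + m3 * n4) ^+ 2
   + ((m2 * n1 + m4 * n3) ^+ 2 + (m2 * n2 + m4 * n4) ^+ 2) =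
   (m1 ^+ 2 + m2 ^+ 2) * (n1 ^+ 2 + n2 ^+ 2)
   + 2 * ((m1 * m3 + m2 * m4) * (n1 * n3 + n2 * n4))
   + (m3 ^+ 2 + m4 ^+ 2) * (n3 ^+ 2 + n4 ^+ 2) by ring.
move: (m1 ^+ 2 + m2 ^+ 2) (n1 ^+ 2 + n2 ^+ 2) (m1 * m3 + m2 * m4)
  (n1 * n3 + n2 * n4) (m3 ^+ 2 + m4 ^+ 2) (n3 ^+ 2 + n4 ^+ 2).
move=> a a' b b' c c'.
have := sqr_ge0 (a * b' - b * a'); have := sqr_ge0 (a * c' - c * a').
have := sqr_ge0 (b * c' - c * b'); lra.
Qed.

Definition depol_vec r f (w : 'I_2 * 'I_2) : R := \sum_v depol_kernel r v w * f v.

Lemma depol_vec_4norm r f (T := depol_vec r f) : 0 <= r <= 4^-1 ->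
  (T (ord0, ord0) ^+ 2 + T (ord0, ord_max) ^+ 2) ^+ 2
  + 2 * (T (ord0, ord0) * T (ord_max, ord0)
         + T (ord0, ord_max) * T (ord_max, ord_max)) ^+ 2
  + (T (ord_max, ord0) ^+ 2 + T (ord_max, ord_max) ^+ 2) ^+ 2
  <= 2^-1 * (\sum_v f v ^+ 2) ^+ 2.
Proof.
move=> r4; have E w : T w = \sum_v depol_kernel r v w * f v by [].
rewrite !E !big_pair2 !big_ord2 /depol_kernel !xpair_eqE /=.
move: (f _) (f _) (f _) (f _) => d c b a.
have := qubit_4norm ((a + d) / 2) ((a - d) / 2) b c r4.
by congr (_ <= _); field.
Qed.

Lemma gram_kernel_sum r f g (w : 'I_2 * 'I_2) :
  \sum_u \sum_v gram_kernel r u v w * (f u * g v) =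
  \sum_z depol_vec r f (z, w.1) * depol_vec r g (z, w.2).
Proof.
rewrite /depol_vec /gram_kernel.
under eq_bigr => u _ do under eq_bigr => v _ do rewrite mulr_suml.
under eq_bigr => u _ do rewrite exchange_big.
rewrite exchange_big; apply: eq_bigr => z _ /=; rewrite mulr_suml.
apply: eq_bigr => u _; rewrite mulr_sumr; apply: eq_bigr => v _; ring.
Qed.

Lemma qubit_trilinear r f g h : 0 <= r <= 4^-1 ->
  \sum_u \sum_v \sum_w gram_kernel r u v w * (f u * g v * h w) <=
  Num.sqrt 2^-1 * (Num.sqrt (\sum_x f x ^+ 2) * Num.sqrt (\sum_x g x ^+ 2)
                   * Num.sqrt (\sum_x h x ^+ 2)).
Proof.
move=> r4; pose W w := \sum_z depol_vec r f (z, w.1) * depol_vec r g (z, w.2).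
have -> : \sum_u \sum_v \sum_w gram_kernel r u v w * (f u * g v * h w) =
    \sum_w W w * h w.
  under eq_bigr => u _ do rewrite exchange_big.
  rewrite exchange_big; apply: eq_bigr => w _ /=.
  rewrite /W -gram_kernel_sum mulr_suml; apply: eq_bigr => u _.
  by rewrite mulr_suml; apply: eq_bigr => v _; rewrite !mulrA.
apply: le_trans (sum_CS_sqrt _ _) _.
rewrite mulrA ler_wpM2r ?sqrtr_ge0 //.
have F0 : 0 <= \sum_x f x ^+ 2 by apply: sumr_ge0 => i _; exact: sqr_ge0.
have G0 : 0 <= \sum_x g x ^+ 2 by apply: sumr_ge0 => i _; exact: sqr_ge0.
have W0 : 0 <= \sum_w W w ^+ 2 by apply: sumr_ge0 => i _; exact: sqr_ge0.
rewrite -!sqrtrM ?invr_ge0 //; apply: ler_wsqrtr.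
rewrite -(@ler_pXn2r _ 2) ?nnegrE ?mulr_ge0 ?invr_ge0 //.
have E : (2^-1 * ((\sum_x f x ^+ 2) * (\sum_x g x ^+ 2))) ^+ 2 =
  2^-1 * (\sum_x f x ^+ 2) ^+ 2 * (2^-1 * (\sum_x g x ^+ 2) ^+ 2) by ring.
rewrite E; apply: le_trans (ler_pM _ _ (depol_vec_4norm f r4) (depol_vec_4norm g r4)).
- by rewrite big_pair2 !big_ord2 /W /= !big_ord2; exact: gram_2x2.
- by rewrite !addr_ge0 ?sqr_ge0 // mulr_ge0 ?sqr_ge0.
- by rewrite !addr_ge0 ?sqr_ge0 // mulr_ge0 ?sqr_ge0.
Qed.

End OneQubit.

(** * Hypercontractivity *)

Section NoiseKernel.
Variables (R : realType) (n : nat).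
Implicit Types (r : R) (A : qop R n) (F : 'I_n -> 'M[R[i]]_2) (s : seq 'I_n).

Definition depol2 r (G : 'M[R[i]]_2) : 'M[R[i]]_2 :=
  (1 - r)%:C *: (2^-1 * \tr G)%:M + r%:C *: G.

Lemma tensorE F (i : 'I_n) (G : 'M[R[i]]_2) x y :
  tensor (fun k => if k == i then G else F k) x y =
  G (bits x i) (bits y i)
  * \prod_(k < n | k != i) F k (bits x k) (bits y k).
Proof.
rewrite mxE (bigD1 i) //= eqxx; congr (_ * _).
by apply: eq_bigr => k /negbTE ->.
Qed.

Lemma depol_tensor r i F :
  depol r i (tensor F) = tensor (fun k => if k == i then depol2 r (F k) else F k).
Proof.
have -> : depol r i (tensor F) =
    (1 - r)%:C *: tauj i (tensor F) + r%:C *: tensor F.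
  by rewrite depolE /dj scalerBr [in LHS]addrA addrAC rmorphB rmorph1 scalerBl scale1r.
have EF G : tensor (fun k => if k == i then G k else F k) =
            tensor (fun k => if k == i then G i else F k).
  by congr tensor; apply/funext => k; case: eqP => [->|].
rewrite tauj_tensor (EF (fun k => depol2 r (F k))).
rewrite (EF (fun k => (2^-1 * \tr (F i))%:M)).
have FE : tensor F = tensor (fun k => if k == i then F i else F k).
  by congr tensor; apply/funext => k; case: eqP => [->|].
rewrite [X in _ + _ *: X = _]FE.
apply/matrixP => x y; rewrite [LHS]mxE [X in X + _]mxE [X in _ + X]mxE !tensorE.
by rewrite !mulrA -mulrDl !mxE.
Qed.

Lemma noise_tensor r s F : uniq s ->
  noise r s (tensor F) =
  tensor (fun k => if k \in s then depol2 r (F k) else F k).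
Proof.
elim: s => //= i s IH /andP[ins us]; rewrite IH // depol_tensor.
congr tensor; apply/funext => k; rewrite in_cons.
by case: eqP => //= ->; rewrite (negbTE ins).
Qed.

Lemma depol2_delta r (a b c d : 'I_2) :
  depol2 r (delta_mx a b) c d = (depol_kernel r (a, b) (c, d))%:C.
Proof.
rewrite /depol2; have -> : \tr (delta_mx a b : 'M[R[i]]_2) = (a == b)%:R.
  rewrite /mxtrace (bigD1 a) //= big1 => [|k ka]; last by rewrite mxE (negbTE ka).
  by rewrite mxE eqxx addr0.
rewrite /depol_kernel !mxE /= xpair_eqE [RHS]rmorphD /= !(rmorphM (real_complex R)) /=.
rewrite fmorphV !rmorph_nat -mulrA; congr (_ * _ + _).
by case: (a == b); case: (c == d); rewrite /= ?mulr1n ?mulr0n ?mulr1 ?mulr0.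
Qed.

Lemma noise_sum r s (I : Type) (t : seq I) (P : pred I) (B : I -> qop R n) :
  noise r s (\sum_(i <- t | P i) B i) = \sum_(i <- t | P i) noise r s (B i).
Proof.
apply: (big_morph _ (noiseD r s)).
by have := noiseB r s 0 0; rewrite !subrr.
Qed.

Lemma qnoiseE r A x y :
  qnoise r A x y = \sum_a \sum_b A a b *
    (\prod_j depol_kernel r (bits a j, bits b j) (bits x j, bits y j))%:C.
Proof.
rewrite /qnoise [in LHS](tensor_span A) noise_sum summxE; apply: eq_bigr => a _.
rewrite noise_sum summxE; apply: eq_bigr => b _.
rewrite noiseZ noise_tensor ?enum_uniq // mxE; congr (_ * _).
rewrite mxE rmorph_prod; apply: eq_bigr => j _.
by rewrite mem_enum inE depol2_delta.
Qed.

End NoiseKernel.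

Section Hypercontractivity.
Variables (R : realType) (n : nat).
Implicit Types (r : R) (A B : qop R n).

Notation X := ('I_2 * 'I_2)%type.

Definition lbits (v : {ffun 'I_n -> X}) : 'I_(qdim n) :=
  unbits [ffun j => (v j).1].
Definition rbits (v : {ffun 'I_n -> X}) : 'I_(qdim n) :=
  unbits [ffun j => (v j).2].

Lemma big_bits (V : nmodType) (F : bitstr n -> V) :
  \sum_(a : 'I_(qdim n)) F (bits a) = \sum_u F u.
Proof.
rewrite [RHS](reindex (@bits n)) //=.
by apply: onW_bij; exists (@unbits n) => x; rewrite ?bitsK ?unbitsK.
Qed.

Lemma big_pair_bits (V : nmodType) (F : 'I_(qdim n) -> 'I_(qdim n) -> V) :
  \sum_a \sum_b F a b = \sum_v F (lbits v) (rbits v).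
Proof.
rewrite pair_bigA /= (reindex (fun v => (lbits v, rbits v))) //=.
apply: onW_bij.
exists (fun p : 'I_(qdim n) * 'I_(qdim n) => [ffun j => (bits p.1 j, bits p.2 j)]).
  move=> v; apply/ffunP => j; rewrite ffunE /= !unbitsK !ffunE.
  by case: (v j).
move=> [a b] /=; congr (_, _); apply: bits_inj; rewrite unbitsK;
  by apply/ffunP => j; rewrite !ffunE.
Qed.

Definition cabs (z : R[i]) : R := complex.Re `|z|.

Lemma cabs_ge0 z : 0 <= cabs z.
Proof. by case: z => a b; rewrite /cabs normc_def /= sqrtr_ge0. Qed.

Lemma cabsC z : `|z| = (cabs z)%:C.
Proof. by rewrite /cabs normc_def. Qed.

Lemma cabsM z w : cabs (z * w) = cabs z * cabs w.
Proof. by rewrite /cabs normrM (cabsC z) ReZ. Qed.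

Lemma cabs_real (c : R) : 0 <= c -> cabs c%:C = c.
Proof. by move=> c0; rewrite /cabs ger0_norm // ler0c. Qed.

Lemma cabs_conj z : cabs z^* = cabs z.
Proof. by case: z => a b; rewrite /cabs !normc_def /= sqrrN. Qed.

Lemma cabs_sum (I : Type) (t : seq I) (F : I -> R[i]) :
  cabs (\sum_(i <- t) F i) <= \sum_(i <- t) cabs (F i).
Proof.
rewrite -lecR -cabsC rmorph_sum /=; apply: le_trans (ler_norm_sum _ _ _) _.
by apply: ler_sum => i _; rewrite cabsC.
Qed.

Lemma hs_cabs A : hs A A = \sum_v cabs (A (lbits v) (rbits v)) ^+ 2.
Proof. by rewrite hs_norm2 exchange_big /= big_pair_bits. Qed.

Lemma cabs_qnoise r A x y : 0 <= r <= 1 ->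
  cabs (qnoise r A x y) <= \sum_v cabs (A (lbits v) (rbits v)) *
    \prod_j depol_kernel r (v j) (bits x j, bits y j).
Proof.
move=> r01; rewrite qnoiseE big_pair_bits; apply: le_trans (cabs_sum _ _) _.
apply: ler_sum => v _; rewrite cabsM cabs_real; last first.
  by apply: prodr_ge0 => j _; exact: depol_kernel_ge0.
rewrite ler_wpM2l ?cabs_ge0 // le_eqVlt; apply/orP; left; apply/eqP.
by apply: eq_bigr => j _; rewrite !unbitsK !ffunE; case: (v j).
Qed.

Lemma cabs_gram r A w : 0 <= r <= 1 ->
  cabs ((adj (qnoise r A) *m qnoise r A) (lbits w) (rbits w)) <=
  \sum_(u : {ffun 'I_n -> X}) \sum_(v : {ffun 'I_n -> X})
    (\prod_j gram_kernel r (u j) (v j) (w j)) *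
    (cabs (A (lbits u) (rbits u)) * cabs (A (lbits v) (rbits v))).
Proof.
move=> r01; rewrite mxE; apply: le_trans (cabs_sum _ _) _.
apply: (@le_trans _ _ (\sum_(z : bitstr n)
   (\sum_u cabs (A (lbits u) (rbits u)) * \prod_j depol_kernel r (u j) (z j, (w j).1)) *
   (\sum_v cabs (A (lbits v) (rbits v)) * \prod_j depol_kernel r (v j) (z j, (w j).2)))).
  rewrite -big_bits; apply: ler_sum => z _; rewrite adjE cabsM cabs_conj.
  apply: ler_pM; rewrite ?cabs_ge0 //; apply: le_trans (cabs_qnoise _ _ _ r01) _;
    rewrite le_eqVlt; apply/orP; left; apply/eqP; apply: eq_bigr => u _;
    by congr (_ * _); apply: eq_bigr => j _; rewrite unbitsK ffunE.
rewrite le_eqVlt; apply/orP; left; apply/eqP.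
under eq_bigr => z _ do rewrite mulr_suml.
rewrite exchange_big; apply: eq_bigr => u _ /=.
under eq_bigr => z _ do rewrite mulr_sumr.
rewrite exchange_big; apply: eq_bigr => v _ /=.
rewrite /gram_kernel bigA_distr_bigA mulr_suml /=; apply: eq_bigr => z _.
by rewrite big_split /=; ring.
Qed.

(** For [r <= 1 / 4] noise is contractive from the normalized 2-norm to the
    normalized 4-norm. In the basis of matrix units its coefficients are nonnegative, so that the
    entries of [A] may be replaced by their absolute values, and they are products
    over the sites, so that the estimate tensorizes from one qubit. The third
    argument of the trilinear form has the absolute values of the entries of [Y]
    themselves, which gives the norm of [Y] by duality. *)
Theorem hypercontractivity r A (Y := adj (qnoise r A) *m qnoise r A) :
  0 <= r <= 4^-1 ->
  hs Y Y <= hs A A ^+ 2 / 2 ^+ n.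
Proof.
move=> r4; have r01 : 0 <= r <= 1.
  by case/andP: r4 => r0 r4; apply/andP; split; lra.
pose g v := cabs (A (lbits v) (rbits v)).
pose D w := cabs (Y (lbits w) (rbits w)).
have HG : hs A A = \sum_v g v ^+ 2 by exact: hs_cabs.
have HD : hs Y Y = \sum_w D w ^+ 2 by exact: hs_cabs.
have G0 := hs_ge0 A; have D0 := hs_ge0 Y.
have : hs Y Y <= trilinear (gram_kernel r) g g D.
  rewrite HD /trilinear.
  apply: (@le_trans _ _ (\sum_(w : {ffun 'I_n -> X})
    (\sum_(u : {ffun 'I_n -> X}) \sum_(v : {ffun 'I_n -> X}) (\prod_j gram_kernel r (u j) (v j) (w j)) *
    (g u * g v)) * D w)).
    by apply: ler_sum => w _; rewrite expr2 ler_wpM2r ?cabs_ge0 //; exact: cabs_gram.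
  rewrite le_eqVlt; apply/orP; left; apply/eqP.
  under eq_bigr => w _ do rewrite mulr_suml.
  rewrite exchange_big; apply: eq_bigr => u _ /=.
  under eq_bigr => w _ do rewrite mulr_suml.
  rewrite exchange_big; apply: eq_bigr => v _ /=.
  by apply: eq_bigr => w _; rewrite !mulrA.
move=> /le_trans/(_ (trilinear_le (sqrtr_ge0 2^-1) _ _ _ _ _)).
move=> H; have {}H : hs Y Y <= Num.sqrt 2^-1 ^+ n * (Num.sqrt (hs A A) * Num.sqrt (hs A A) * Num.sqrt (hs Y Y)).
  rewrite HG [in leRHS]HD; apply: H => *; try exact: cabs_ge0.
    exact: gram_kernel_ge0.
  exact: qubit_trilinear.
have {}H : Num.sqrt (hs Y Y) <= Num.sqrt 2^-1 ^+ n * hs A A.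
  move: H; rewrite -expr2 sqr_sqrtr //.
  have [->|Y0] := eqVneq (hs Y Y) 0.
    by rewrite sqrtr0 => _; rewrite mulr_ge0 ?exprn_ge0 ?sqrtr_ge0.
  have sp : 0 < Num.sqrt (hs Y Y) by rewrite sqrtr_gt0 lt_neqAle eq_sym Y0.
  by rewrite -{1}(sqr_sqrtr D0) expr2 mulrA ler_pM2r.
rewrite -(sqr_sqrtr D0).
have -> : hs A A ^+ 2 / 2 ^+ n = (Num.sqrt 2^-1 ^+ n * hs A A) ^+ 2.
  by rewrite exprMn exprAC sqr_sqrtr ?invr_ge0 // exprVn mulrC.
by rewrite lerXn2r // nnegrE ?sqrtr_ge0 // mulr_ge0 ?exprn_ge0 ?sqrtr_ge0.
Qed.

End Hypercontractivity.

(** * Truncation of singular values *)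

Section SpectralCut.
Variables (R : realType) (n : nat).
Implicit Types (A B k h : qop R n) (r L : R).

#[local] Arguments depol_kernel : simpl never.

Lemma depol_kernel0_prod (a b x y : 'I_(qdim n)) :
  \prod_j depol_kernel (0 : R) (bits a j, bits b j) (bits x j, bits y j) =
  (2 ^+ n)^-1 * ((a == b) && (x == y))%:R.
Proof.
case: (boolP (_ && _)) => [/andP[/eqP <- /eqP <-]|neq].
  rewrite mulr1 -exprVn (eq_bigr (fun=> 2^-1)) => [|j _].
    by rewrite prodr_const card_ord.
  by rewrite /depol_kernel !eqxx subr0 mul1r mulr1 mul0r addr0.
rewrite mulr0; apply/eqP; apply: contraNT neq => /prodf_neq0 H.
have E j : (bits a j == bits b j) && (bits x j == bits y j).
  by have := H j isT; rewrite /depol_kernel mul0r addr0; case: (_ && _);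
     rewrite //= mulr0 eqxx.
by apply/andP; split; apply/eqP/bits_inj/ffunP => j; case/andP: (E j) => /eqP ? /eqP ?.
Qed.

Lemma qnoise0 A : qnoise 0 A = (ntrace A)%:M.
Proof.
apply/matrixP => x y; rewrite qnoiseE !mxE /ntrace /mxtrace.
have E a : \sum_b A a b * (\prod_j depol_kernel (0 : R)
      (bits a j, bits b j) (bits x j, bits y j))%:C =
    A a a * ((2 ^+ n)^-1 * (x == y)%:R)%:C.
  rewrite (bigD1 a) //= [X in _ + X]big1 ?addr0 => [|b ba].
    by rewrite depol_kernel0_prod eqxx.
  by rewrite depol_kernel0_prod eq_sym (negbTE ba) mulr0 mulr0.
rewrite (eq_bigr _ (fun a _ => E a)) -mulr_suml mulrC.
rewrite !(rmorphM (real_complex R)) fmorphV rmorphXn !rmorph_nat.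
by case: (x == y); rewrite ?mulr1 ?mulr0 ?mul0r ?mulr1n ?mulr0n.
Qed.

Definition centered A : qop R n := A - qnoise 0 A.

Lemma qnoise_qnoise r r' A : qnoise r (qnoise r' A) = qnoise (r * r') A.
Proof. exact: noise_noise. Qed.

Lemma qnoiseB r A B : qnoise r (A - B) = qnoise r A - qnoise r B.
Proof. exact: noiseB. Qed.

Lemma hs_qnoise r A B : hs (qnoise r A) B = hs A (qnoise r B).
Proof. exact: hs_noise. Qed.

Lemma hs_centered A h : hs A (h - qnoise 0 h) = hs (centered A) h.
Proof. by rewrite /centered hsBr hsBl hs_qnoise. Qed.

(** Noise fixes the scalars and is self-adjoint, so that the trace of [A] drops
    out. *)
Lemma centered_noise r A :
  hs A (A - qnoise r A) = hs (centered A) (centered A - qnoise r (centered A)).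
Proof.
have -> : centered A - qnoise r (centered A) = A - qnoise r A.
  by rewrite /centered qnoiseB qnoise_qnoise mulr0 opprB addrA subrK.
by rewrite /centered hsBl hs_qnoise qnoiseB qnoise_qnoise mul0r subrr hs0r subr0.
Qed.

Lemma qvar_centered A : 2 ^+ n * qvar A = hs (centered A) (centered A).
Proof. by rewrite qvarE /centered qnoise0 mulrC divfK ?expf_neq0. Qed.

Lemma qvar_ge0 A : 0 <= qvar A.
Proof. by rewrite /qvar exprn_ge0 // /pnorm powR_ge0. Qed.

Lemma centered_le A : hs (centered A) (centered A) <= hs A A.
Proof.
have : 0 <= hs (qnoise 0 A) (qnoise 0 A) by exact: hs_ge0.
rewrite hs_qnoise qnoise_qnoise mul0r {1 2}/centered.
rewrite !(hsBl, hsBr) hs_qnoise !hs_qnoise qnoise_qnoise mul0r; lra.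
Qed.

(** Decomposition of [B] into the parts where its singular values are at most,
    respectively larger than, [L]. The high part [k] is supported on a
    projection [Q] of normalized trace at most the squared 2-norm of [k] over
    [L ^ 2]; testing [Q] against [|qnoise r k|^2] by Cauchy-Schwarz lets the
    4-norm of [qnoise r k] enter, which hypercontractivity bounds. In the last
    clause an eigenvalue [z <= 1] of [B^* B] satisfies [z ^ 2 + b = a z >= 2 z],
    hence [z <= b]. *)
Lemma spectral_cut B L : 0 < L -> exists h k,
  [/\ B = h + k, opbound L h /\ hs B h = hs h h, hs k k <= hs B B,
      forall r, 0 <= r <= 4^-1 ->
        hs k (qnoise r k) ^+ 4 <= hs B B ^+ 5 / (2 ^+ n * L ^+ 2)
    & forall a b : R, 2 <= a -> 0 <= b -> L <= 1 ->
        (adj B *m B) *m (adj B *m B) + b%:C *: 1%:M = a%:C *: (adj B *m B) ->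
        hs h h <= 2 ^+ n * b].
Proof.
move=> L0; have aux (s t u b : R) : s + b = t -> 2 * u <= t -> s <= u -> u <= b.
  by lra.
have [||U [z [Uu z0 ZE]]] := @spectral_psd R _ (adj B *m B).
- by rewrite adjM adjK.
- exact: psd_gram.
pose q i : R := (L ^+ 2 < z i)%R%:R; pose q' i : R := 1 - q i.
have qq i : q i * q i = q i by rewrite /q -natrM mulnb andbb.
have q'q' i : q' i * q' i = q' i by rewrite /q' mulrBl mul1r mulrBr mulr1 qq; ring.
have q01 i : 0 <= q i <= 1 by rewrite /q; case: (_ < _); rewrite /= ?lexx ler01.
pose Q := specmx U q; pose Q' := specmx U q'.
have QA : adj Q = Q by exact: adj_specmx.
have QA' : adj Q' = Q' by exact: adj_specmx.
have QQ : Q *m Q = Q.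
  by rewrite /Q (specmxM Uu); congr specmx; apply/funext.
pose h := B *m Q'; pose k := B *m Q.
have hk : B = h + k.
  rewrite /h /k -mulmxDr -[LHS]mulmx1 -(specmx1 Uu); congr (_ *m _).
  have -> : Q' = specmx U (fun=> 1) - Q by rewrite (specmxB U).
  by rewrite subrK.
have hZ : adj h *m h = specmx U (fun i => q' i * z i).
  have -> : adj h *m h = Q' *m (adj B *m B) *m Q'.
    by rewrite /h adjM QA' !mulmxA.
  rewrite ZE !(specmxM Uu); congr specmx; apply/funext => i.
  by rewrite mulrAC q'q'.
have kZ : adj k *m k = specmx U (fun i => q i * z i).
  have -> : adj k *m k = Q *m (adj B *m B) *m Q.
    by rewrite /k adjM QA !mulmxA.
  rewrite ZE !(specmxM Uu); congr specmx; apply/funext => i.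
  by rewrite mulrAC qq.
have hh : hs h h = \sum_i q' i * z i by rewrite hs_rtr hZ (rtr_specmx Uu).
have kk : hs k k = \sum_i q i * z i by rewrite hs_rtr kZ (rtr_specmx Uu).
have BB : hs B B = \sum_i z i by rewrite hs_rtr ZE (rtr_specmx Uu).
have V0 := hs_ge0 B.
have kB : hs k k <= hs B B.
  rewrite kk BB; apply: ler_sum => i _.
  by rewrite ler_piMl //; case/andP: (q01 i).
exists h, k; split=> //.
- split.
    move=> w; rewrite hZ -qf1 -qfZ -(specmx_cst Uu).
    apply: ler_qf_specmx => // i; rewrite /q' /q.
    case: ltP => zL; first by rewrite subrr mul0r sqr_ge0.
    by rewrite subr0 mul1r.
  rewrite hh hs_rtr /h mulmxA ZE /Q' (specmxM Uu) (rtr_specmx Uu).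
  by apply: eq_bigr => i _; rewrite mulrC.
- move=> r r4; set P := qnoise r k; set Y := adj P *m P.
  (* Chebyshev: the eigenvalues [z i] exceed [L ^ 2] on the range of [Q]. *)
  have Q2 : hs Q Q <= hs B B / L ^+ 2.
    rewrite ler_pdivlMr ?exprn_gt0 // hs_rtr QA QQ /Q (rtr_specmx Uu).
    rewrite mulr_suml BB; apply: ler_sum => i _; rewrite /q.
    by case: ltP => zL; rewrite ?mul1r ?mul0r // ltW.
  have H1 : hs k P ^+ 2 <= hs B B * hs Y Q.
    have -> : hs k P = hs k (P *m Q).
      by rewrite -{1}[Q]QA -hs_mulr /k -mulmxA QQ.
    have -> : hs Y Q = hs (P *m Q) (P *m Q).
      by rewrite [RHS]hs_mull mulmxA -{3}QA -hs_mulr QQ hsC.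
    by apply: le_trans (hs_CS _ _) _; rewrite ler_wpM2r ?hs_ge0.
  have H2 : hs Y Q ^+ 2 <= hs B B ^+ 2 / 2 ^+ n * (hs B B / L ^+ 2).
    apply: le_trans (hs_CS _ _) _; apply: ler_pM; rewrite ?hs_ge0 //.
    apply: le_trans (hypercontractivity k r4) _.
    by rewrite ler_wpM2r ?invr_ge0 ?exprn_ge0 // lerXn2r // nnegrE hs_ge0.
  have -> : hs k P ^+ 4 = (hs k P ^+ 2) ^+ 2 by rewrite -exprM.
  apply: (@le_trans _ _ ((hs B B * hs Y Q) ^+ 2)).
    rewrite lerXn2r // nnegrE ?sqr_ge0 //.
    exact: le_trans (sqr_ge0 _) H1.
  rewrite exprMn; apply: le_trans (ler_wpM2l (sqr_ge0 _) H2) _.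
  rewrite le_eqVlt; apply/orP; left; apply/eqP.
  by field; rewrite expf_neq0 // gt_eqF.
- move=> a b a2 b0 L1 E; rewrite hh.
  have zb i : q' i * z i <= b.
    have zE : z i * z i + b = a * z i.
      have := congr1 (qf (uvec U i)) E.
      by rewrite qfD !qfZ qf_uvec1 // mulr1 ZE (specmxM Uu) !(qf_uvec_specmx Uu).
    have az : 2 * z i <= a * z i by rewrite ler_wpM2r.
    rewrite /q' /q; case: ltP => zL; first by rewrite subrr mul0r.
    rewrite subr0 mul1r.
    have z1 : z i <= 1.
      by apply: le_trans zL _; rewrite expr_le1 // ltW.
    have zz : z i * z i <= z i by rewrite ler_piMl.
    exact: aux zE az zz.
  apply: le_trans (ler_sum _ (fun i _ => zb i)) _.
  by rewrite sumr_const card_ord qdimE -[b *+ _]mulr_natl natrX.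
Qed.

End SpectralCut.

(** * Decay of the high part and the dichotomy *)

Section Decay.
Variables (R : realType) (n : nat).
Implicit Types (A B k h : qop R n) (r L p x y v V E : R).

Lemma expRN2_le : expR (- 2) <= 4^-1 :> R.
Proof.
have h1 := expR_ge1Dx (1 : R).
have -> : - 2 = -1 + -1 :> R by ring.
rewrite expRD expRN -invfM lef_pV2 ?posrE ?mulr_gt0 ?expR_gt0 //.
have -> : 4 = (1 + 1) * (1 + 1) :> R by ring.
by rewrite ler_pM.
Qed.

(** The function [t => hs k (qnoise (exp (- t)) k)] is log-convex. Only repeated
    halving of [t] is needed, and there log-convexity is the Cauchy-Schwarz
    inequality between [k] and [qnoise r k]. *)
Lemma noise_decay k V y : 0 <= V -> hs k k <= V ->
  hs k (qnoise (expR (- 2)) k) <= V * expR (- y) ->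
  forall m, hs k (qnoise (expR (- (2 / 2 ^+ m))) k) <= V * expR (- (y / 2 ^+ m)).
Proof.
move=> V0 kV H; elim=> [|m IH]; first by rewrite !expr0 !divr1.
have half (t : R) : expR (- (t / 2 ^+ m)) =
    expR (- (t / 2 ^+ m.+1)) * expR (- (t / 2 ^+ m.+1)).
  rewrite -expRD; congr expR; rewrite exprS; field.
  by rewrite expf_neq0.
rewrite (half 2) in IH; set r := expR (- (2 / 2 ^+ m.+1)) in IH *.
rewrite -(@ler_pXn2r _ 2) //; last first.
- by rewrite nnegrE mulr_ge0 // expR_ge0.
- by rewrite nnegrE; apply: hs_noise_ge0; exact: expR_ge0.
apply: le_trans (hs_CS _ _) _.
rewrite -hs_noise_sq -/(qnoise _ _).
have -> : (V * expR (- (y / 2 ^+ m.+1))) ^+ 2 = V * (V * expR (- (y / 2 ^+ m))).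
  by rewrite half; ring.
apply: ler_pM; rewrite ?hs_ge0 //.
by apply: hs_noise_ge0; rewrite mulr_ge0 // expR_ge0.
Qed.

Lemma dyadic_scale x : 16 <= x -> exists m, 16 * 2 ^+ m <= x < 32 * 2 ^+ m.
Proof.
move=> x16; have x0 : 0 <= x / 16 by lra.
have /andP[t1 t2] := truncn_itv x0; set t := Num.trunc _ in t1 t2.
have tp : (0 < t)%N.
  rewrite lt0n; apply/negP => /eqP t0; rewrite t0 in t2.
  by move: t2; rewrite ltNge => /negP; apply; lra.
have /andP[m1 m2] := trunc_log_bounds (isT : 1 < 2)%N tp.
exists (trunc_log 2 t); apply/andP; split.
  have : (2 ^+ trunc_log 2 t : R) <= t%:R by rewrite -natrX ler_nat.
  lra.
have : (t.+1%:R : R) <= 2 ^+ (trunc_log 2 t).+1 by rewrite -natrX ler_nat.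
rewrite exprS; lra.
Qed.

(** Solved for [E], by means of [1 + x / 2 <= x] and [64 ^ (p / 2) <= 64]. *)
Lemma energy_lower_bound p x v E u : 1 <= p <= 2 -> 16 <= x -> 0 <= v -> 0 <= u ->
  u <= 64 / x -> 0 <= E -> 9 / 32 * v <= 16 * E * u `^ (p / 2) ->
  4096^-1 * (v * (1 + x / 2) `^ (p / 2)) <= E.
Proof.
move=> /andP[p1 p2] x16 v0 u0 ux E0 H; set l := 1 + x / 2.
have l0 : 0 < l by rewrite /l; lra.
have L0 : 0 < l `^ (p / 2) by exact: powR_gt0.
have hu : u `^ (p / 2) <= 64 / l `^ (p / 2).
  apply: (@le_trans _ _ ((64 / l) `^ (p / 2))).
    apply: ge0_ler_powR; rewrite ?nnegrE //; first lra.
      by rewrite divr_ge0 // ltW.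
    apply: le_trans ux _; rewrite ler_pM2l //.
    by rewrite lef_pV2 ?posrE // /l; lra.
  rewrite powRM ?invr_ge0 ?(ltW l0) // -[l^-1]powR_inv1 ?(ltW l0) // -powRrM.
  rewrite mulN1r powRN ler_wpM2r ?invr_ge0 ?(ltW L0) //.
  by apply: ler1_powR; lra.
have {}H : 9 / 32 * v <= 16 * E * (64 / l `^ (p / 2)).
  by apply: le_trans H _; rewrite ler_wpM2l // mulr_ge0.
rewrite mulrA -ler_pdivlMr //.
move: H; rewrite mulrA; move: ((l `^ (p / 2))^-1) => w; lra.
Qed.

Lemma log_bound_le p v : 1 <= p <= 2 -> 0 < v <= 1 ->
  log_bound p v <= v * (1 + ln (1 / v) / 2).
Proof.
move=> /andP[p1 p2] /andP[v0 v1]; rewrite /log_bound gt_eqF //.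
have : 0 <= ln (1 / v) by rewrite ln_ge0 // div1r invf_ge1.
move: (ln _) => x x0; rewrite ler_wpM2l ?(ltW v0) // [2^-1 * x]mulrC.
by apply: ler1_powR; lra.
Qed.

(** The noise that destroys a fixed part of [k] is of strength of order
    [1 / x]: it is obtained from [exp (- 2)] by about [log_2 (x / 16)] halvings
    of the exponent, after which the gain [exp (- x / 8)] has become a constant. *)
Lemma noise_decay_high k V x : 0 <= V -> hs k k <= V -> 16 <= x ->
  hs k (qnoise (expR (- 2)) k) <= V * expR (- (x / 8)) ->
  exists2 r, 0 <= r < 1 & 1 - r <= 64 / x /\ hs k (qnoise r k) <= V / 4.
Proof.
move=> V0 kV x16 H; have [m /andP[m1 m2]] := dyadic_scale x16.
have m0 : (0 : R) < 2 ^+ m by rewrite exprn_gt0.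
have i0 : (0 : R) < 2 / 2 ^+ m by rewrite divr_gt0.
exists (expR (- (2 / 2 ^+ m))).
  by rewrite expR_ge0 /= -expR0 ltr_expR oppr_lt0.
split.
  have h1 := expR_ge1Dx (- (2 / 2 ^+ m) : R).
  have h2 : 2 / 2 ^+ m <= 64 / x.
    rewrite ler_pdivlMr; last lra.
    by rewrite mulrAC ler_pdivrMr //; lra.
  lra.
apply: le_trans (noise_decay V0 kV H m) _.
rewrite ler_wpM2l //; apply: le_trans expRN2_le.
rewrite ler_expR lerN2 ler_pdivlMr //; lra.
Qed.

(** With [v = exp (- x)], the observable is cut at the singular value
    [L = v ^ (1 / 4)], the geometric mean of the size [v ^ (1 / 2)] expected from
    the variance and of the largest possible size [1]. If little of the variance
    is carried by the small singular values, the other ones are so sparse that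
    noise of strength [1 / x] destroys part of the variance, and
    [short_time_variance] bounds the energy from below. If [x] is bounded, full
    noise serves the same purpose. *)
Lemma energy_dichotomy p A (v := qvar A) (x := ln (1 / v))
    (B := centered A) :
  1 <= p <= 2 -> opbound 1 A -> 0 < v <= 1 ->
  4096^-1 * log_bound p v <= energy p A \/
  16 <= x /\ exists h,
    [/\ opbound (expR (- (x / 4))) h, hs A (h - qnoise 0 h) = hs h h,
        2 ^+ n * v / 16 < hs h h
      & forall a b : R, 2 <= a -> 0 <= b ->
        (adj B *m B) *m (adj B *m B) + b%:C *: 1%:M = a%:C *: (adj B *m B) ->
        hs h h <= 2 ^+ n * b].
Proof.
move=> p12 hA v01; have /andP[v0 v1] := v01; have /andP[p1 p2] := p12.
have N0 : (0 : R) < 2 ^+ n by rewrite exprn_gt0.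
have E0 := energy_ge0 p A.
have V0 : 0 <= 2 ^+ n * v by rewrite mulr_ge0 ?ltW.
have VE : hs B B = 2 ^+ n * v by rewrite -qvar_centered.
have [x16|x16] := ltP x 16.
  left; have := @short_time_variance R n p A A 0 1 p12 ltr01 hA.
  rewrite lexx ltr01 => /(_ isT).
  have -> : hs A (A - qnoise 0 A) = hs B B.
    by rewrite centered_noise /B /centered qnoiseB qnoise_qnoise mul0r subrr subr0.
  rewrite VE subr0 !powR1 !mulr1 => H.
  have Ev : 3 / 64 * v <= energy p A.
    rewrite -(ler_pM2l N0); move: H; move: (2 ^+ n) (energy p A) => N E; lra.
  apply: le_trans Ev; have := log_bound_le p12 v01; rewrite -/x.
  have : v * (1 + x / 2) <= v * 9 by rewrite ler_wpM2l ?(ltW v0) //; lra.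
  lra.
have L0 : 0 < expR (- (x / 4)) by exact: expR_gt0.
have L1 : expR (- (x / 4)) <= 1 by rewrite -[leRHS]expR0 ler_expR; lra.
have [h [k [Bhk [hL Bh] kB kH hS]]] := spectral_cut B L0.
have [hlow|hhigh] := leP (hs h h) (2 ^+ n * v / 16); last first.
  right; split=> //; exists h; split=> //; last by move=> a b a2 b0; exact: hS.
  by rewrite hs_centered.
left; have vx : v = expR (- x).
  by rewrite /x div1r lnV ?posrE // opprK lnK ?posrE.
(* Fourth powers: [v ^ 5 / L ^ 2 = v ^ 4 * v ^ (1 / 2)], whence the gain
   [v ^ (1 / 8) = exp (- x / 8)]. *)
have kH' : hs k (qnoise (expR (- 2)) k) <= 2 ^+ n * v * expR (- (x / 8)).
  rewrite -(@ler_pXn2r _ 4) //; last first.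
  - by rewrite nnegrE mulr_ge0 ?expR_ge0.
  - by rewrite nnegrE; apply: hs_noise_ge0; exact: expR_ge0.
  apply: le_trans (kH _ _) _; first by rewrite expR_ge0 expRN2_le.
  have -> : expR (- (x / 4)) ^+ 2 = expR (- (x / 8)) ^+ 4.
    by rewrite -!expRM_natl; congr expR; field.
  have e8 : v = expR (- (x / 8)) ^+ 8.
    by rewrite -expRM_natl vx; congr expR; field.
  rewrite VE e8; move: (expR_gt0 (- (x / 8))).
  move: (expR _) (2 ^+ n) N0 => e N Np ep.
  rewrite le_eqVlt; apply/orP; left; apply/eqP; field.
  by rewrite !gt_eqF.
have kV : hs k k <= 2 ^+ n * v by rewrite -VE.
have [r r01 [ur kr]] := noise_decay_high V0 kV x16 kH'.
have /andP[r0 r1] := r01; have r01' : 0 <= r <= 1 by rewrite r0 ltW.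
have PB : hs B (qnoise r B) <= 5 / 8 * (2 ^+ n * v).
  (* The mixed terms are absorbed by the positivity of the noise at [h - k]. *)
  have hh := hs_noise_le1 (enum 'I_n) h r01'.
  have := hs_noise_ge0 (enum 'I_n) (h - k) r0.
  rewrite -!/(qnoise _ _) in hh *; rewrite Bhk qnoiseB.
  have -> : qnoise r (h + k) = qnoise r h + qnoise r k by exact: noiseD.
  rewrite !(hsBl, hsBr, hsDl, hsDr) in hh *; move: hh kr hlow.
  move: (hs h (qnoise r h)) (hs h (qnoise r k)) (hs k (qnoise r h)).
  move: (hs k (qnoise r k)) (hs h h) (2 ^+ n * v) => a b c d e f; lra.
have := @short_time_variance R n p A A r 1 p12 ltr01 hA r01.
rewrite centered_noise -/B hsBr VE powR1 mulr1 => H.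
have u0 : 0 <= 1 - r by rewrite subr_ge0 ltW.
have := @energy_lower_bound p x v (energy p A) (1 - r) p12 x16 (ltW v0) u0 ur E0.
rewrite /log_bound gt_eqF // -/x [2^-1 * x]mulrC; apply.
rewrite -(ler_pM2l N0); move: PB H.
move: (hs B _) (energy p A) (2 ^+ n) ((1 - r) `^ _) => a E N u; lra.
Qed.

End Decay.

(** * Bounded and Boolean observables *)

Section OperatorNorm.
Variables (R : realType) (n : nat).
Implicit Types A : qop R n.

Lemma opbound_exists A : exists2 C : R, 0 <= C &
  forall w, qf w (adj A *m A) <= C * hs w w.
Proof.
have [||U [l [Uu l0 E]]] := @spectral_psd R _ (adj A *m A).
- by rewrite adjM adjK.
- exact: psd_gram.
exists (\sum_i l i); first by apply: sumr_ge0 => i _.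
move=> w; rewrite E -qf1 -qfZ -(specmx_cst Uu); apply: ler_qf_specmx => i.
by rewrite (bigD1 i) //= lerDl sumr_ge0.
Qed.

(** The supremum defining [opnorm] dominates the elements of its set only
    because that set is bounded, which is [opbound_exists]; homogeneity reduces
    all vectors to the unit ball. *)
Lemma opnorm_opbound A : opnorm A <= 1 -> opbound 1 A.
Proof.
move=> A1; have ball (w : 'cV[R[i]]_(qdim n)) : hs w w <= 1 -> qf w (adj A *m A) <= 1.
  move=> w1; have [C C0 AC] := opbound_exists A.
  have : l2norm (A *m w) <= 1.
    apply: le_trans A1; apply: ub_le_sup; last first.
      exists w => //=; rewrite l2norm_hs -sqrtr1; exact: ler_wsqrtr.
    exists (Num.sqrt C) => _ [u /= u1 <-]; rewrite !l2norm_hs in u1 *.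
    apply: ler_wsqrtr; rewrite -qf_gram; apply: le_trans (AC u) _.
    rewrite ler_piMr //; move: u1; rewrite -{1}sqrtr1 ler_sqrt //.
  by rewrite l2norm_hs -{1}sqrtr1 ler_sqrt // qf_gram.
move=> w; rewrite expr1n mul1r; have w0 := hs_ge0 w.
have sc (c : R) : qf (c%:C *: w) (adj A *m A) = c ^+ 2 * qf w (adj A *m A).
  by rewrite /qf -scalemxAr hsZr hsZl mulrA expr2.
have hc (c : R) : hs (c%:C *: w) (c%:C *: w) = c ^+ 2 * hs w w.
  by rewrite hsZr hsZl mulrA expr2.
have [w00|wn0] := eqVneq (hs w w) 0.
  rewrite w00 leNgt; apply/negP => q0.
  have := ball ((Num.sqrt (2 / qf w (adj A *m A)))%:C *: w).
  rewrite sc hc w00 mulr0 sqr_sqrtr ?divr_ge0 ?(ltW q0) // divfK ?gt_eqF //.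
  by move=> /(_ ler01) h21; lra.
have wp : 0 < hs w w by rewrite lt_neqAle eq_sym wn0.
have := ball ((Num.sqrt (hs w w)^-1)%:C *: w).
rewrite sc hc sqr_sqrtr ?invr_ge0 // mulVf // => /(_ (lexx _)).
by rewrite mulrC ler_pdivrMr // mul1r.
Qed.

Lemma opbound_qvar A : opbound 1 A -> qvar A <= 1.
Proof.
move=> hA; have N0 : (0 : R) < 2 ^+ n by rewrite exprn_gt0.
rewrite -(ler_pM2l N0) qvar_centered mulr1; apply: le_trans (centered_le A) _.
have U1 : (1%:M : qop R n) \is unitarymx.
  by apply/unitarymxP; rewrite mul1mx -/(adj _) adj1.
rewrite hs_rtr (rtr_uvec _ U1).
apply: (@le_trans _ _ (\sum_(i < qdim n) 1)).
  apply: ler_sum => i _; apply: le_trans (hA _) _.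
  by rewrite expr1n mul1r -qf1 qf_uvec1.
by rewrite sumr_const card_ord qdimE -[1 *+ _]mulr_natl mulr1 natrX.
Qed.

End OperatorNorm.

Section Boolean.
Variables (R : realType) (n : nat).
Implicit Types A : qop R n.

Lemma ntrace_real A : adj A = A -> ntrace A = (rtr A / 2 ^+ n)%:C.
Proof.
move=> AA; rewrite -Re_ntrace RRe_real //; apply/CrealP.
rewrite /ntrace rmorphM fmorphV rmorphXn rmorph_nat; congr (_ * _).
by rewrite rmorph_sum; apply: eq_bigr => i _; rewrite -{2}AA !mxE.
Qed.

(** With [c] the normalized trace of [A], the eigenvalues of [Z] are
    [(1 - c) ^ 2] and [(1 + c) ^ 2]: their sum is [2 * (1 + c ^ 2)], and their
    product is the square of the variance [1 - c ^ 2]. *)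
Lemma boolean_centered A (B := centered A) (Z := adj B *m B) :
  quantum_boolean A ->
  exists2 a : R, 2 <= a & Z *m Z + (qvar A ^+ 2)%:C *: 1%:M = a%:C *: Z.
Proof.
move=> [AA A2]; have N0 : (2 ^+ n : R) != 0 by rewrite expf_neq0.
pose c := rtr A / 2 ^+ n.
have BE : B = A - c%:C *: 1%:M.
  by rewrite /B /centered qnoise0 ntrace_real // scalemx1.
have BA : adj B = B by rewrite BE adjB adjZ adj1 /adj AA.
have E1 : (1 + c ^+ 2)%:C = 1 + c%:C ^+ 2 :> R[i].
  by rewrite [LHS]rmorphD rmorph1 rmorphXn.
have E2 : (2 * c)%:C = 2 * c%:C :> R[i].
  by rewrite [LHS](rmorphM (real_complex R)) rmorph_nat.
have E3 : ((1 - c ^+ 2) ^+ 2)%:C = (1 - c%:C ^+ 2) ^+ 2 :> R[i].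
  by rewrite [LHS]rmorphXn rmorphB rmorph1 rmorphXn.
have E4 : (2 * (1 + c ^+ 2))%:C = 2 * (1 + c%:C ^+ 2) :> R[i].
  by rewrite -E1 [LHS](rmorphM (real_complex R)) rmorph_nat.
have ZE : Z = (1 + c ^+ 2)%:C *: 1%:M - (2 * c)%:C *: A.
  rewrite /Z BA BE mulmxBl !mulmxBr -!(scalemxAl, scalemxAr) !mulmx1 !mul1mx A2.
  rewrite E1 E2; move: (1%:M : qop R n) (c%:C) => I1 e.
  apply/matrixP => i j; rewrite !mxE.
  by move: (A i j) (I1 i j) => x y; ring.
have vE : qvar A = 1 - c ^+ 2.
  apply: (mulfI N0); rewrite qvar_centered -/B hs_rtr -/Z ZE /rtr.
  rewrite raddfB /= !mxtraceZ mxtrace1 ReD ReN !ReZ -/(rtr A).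
  have -> : rtr A = 2 ^+ n * c by rewrite /c mulrC divfK.
  have -> : complex.Re ((qdim n)%:R : R[i]) = 2 ^+ n.
    by rewrite qdimE natrX -(rmorph_nat (real_complex R)) -rmorphXn.
  by move: (2 ^+ n) => N; ring.
exists (2 * (1 + c ^+ 2)); first by have := sqr_ge0 c; lra.
rewrite vE ZE mulmxBl !mulmxBr -!(scalemxAl, scalemxAr) !mulmx1 !mul1mx A2.
rewrite E1 E2 E3 E4; move: (1%:M : qop R n) (c%:C) => I1 e.
apply/matrixP => i j; rewrite !mxE.
by move: (A i j) (I1 i j) => x y; ring.
Qed.

End Boolean.

(** * The isoperimetric inequalities *)

Section TwoAlternatives.
Variables (R : realType) (n : nat).
Implicit Types (A : qop R n) (p : R).

Lemma log_bound_ge0 p v : 0 <= v -> 0 <= log_bound p v :> R.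
Proof.
by move=> v0; rewrite /log_bound; case: eqP => // _; rewrite mulr_ge0 ?powR_ge0.
Qed.

(** In the second alternative full noise is applied to the part [h] of small
    singular values: its norm [exp (- x / 4)] enters to the power [2 - p], and
    [exp ((2 - p) * x / 4) >= 1 + (2 - p) * x / 4] beats [(2 - p) * (1 + x / 2)]
    up to a constant. *)
Lemma bounded_energy p A : opbound 1 A -> 1 <= p < 2 ->
  4096^-1 * (2 - p) * log_bound p (qvar A) <= energy p A.
Proof.
move=> hA /andP[p1 p2]; have p12 : 1 <= p <= 2 by rewrite p1 ltW.
have [v0|vn0] := eqVneq (qvar A) 0.
  by rewrite /log_bound v0 eqxx mulr0 energy_ge0.
have v0 : 0 < qvar A by rewrite lt_neqAle eq_sym vn0 qvar_ge0.
have v01 : 0 < qvar A <= 1 by rewrite v0 opbound_qvar.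
have [H|[x16 [h [hL hh hbig _]]]] := energy_dichotomy p12 hA v01.
  apply: le_trans H; have := log_bound_ge0 p (ltW v0).
  move: (log_bound _ _) => l l0.
  have : (2 - p) * l <= 1 * l by rewrite ler_wpM2r //; lra.
  lra.
have lb := log_bound_le p12 v01.
move: v0 lb x16 hL hbig; set v := qvar A; set x := ln _ => v0 lb x16 hL hbig.
have N0 : (0 : R) < 2 ^+ n by rewrite exprn_gt0.
have L0 : 0 < expR (- (x / 4)) by exact: expR_gt0.
have := @short_time_variance R n p A h 0 _ p12 L0 hL.
rewrite lexx ltr01 hh subr0 powR1 mulr1 => /(_ isT) H.
have h0 : 0 <= hs h (qnoise 0 h) by exact: hs_noise_ge0.
rewrite hsBr in H.
have LE : expR (- (x / 4)) `^ (2 - p) = (expR ((2 - p) * x / 4))^-1.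
  by rewrite -expRM -expRN; congr expR; ring.
rewrite LE in H; set w := expR _ in H.
have w0 : 0 < w by exact: expR_gt0.
have w1 : 1 + (2 - p) * x / 4 <= w by exact: expR_ge1Dx.
have E1 : 3 / 1024 * v * w <= energy p A.
  rewrite -ler_pdivlMr // -(ler_pM2l N0).
  move: H h0 hbig.
  move: (hs h h) (hs h _) (energy p A) (w^-1) (2 ^+ n) => a b E u N; lra.
apply: le_trans E1.
have : (2 - p) * log_bound p v <= v * (2 * w).
  apply: (@le_trans _ _ ((2 - p) * (v * (1 + x / 2)))).
    by rewrite ler_wpM2l //; lra.
  rewrite mulrCA ler_wpM2l ?(ltW v0) //; lra.
have : 0 <= v * w by rewrite mulr_ge0 ?ltW.
move: (log_bound _ _) => l; lra.
Qed.

(** The second alternative is impossible here: a singular value that is at most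
    [1] has square at most [v ^ 2], so that the part of small singular values
    carries at most [v ^ 2] of the variance [v]. *)
Lemma boolean_energy p A : quantum_boolean A -> 1 <= p <= 2 ->
  4096^-1 * log_bound p (qvar A) <= energy p A.
Proof.
move=> qA p12; have [AA A2] := qA.
have hA : opbound 1 A.
  by move=> w; rewrite /adj AA A2 qf1 expr1n mul1r.
have [v0|vn0] := eqVneq (qvar A) 0.
  by rewrite /log_bound v0 eqxx mulr0 energy_ge0.
have v0 : 0 < qvar A by rewrite lt_neqAle eq_sym vn0 qvar_ge0.
have v01 : 0 < qvar A <= 1 by rewrite v0 opbound_qvar.
have [//|[x16 [h [_ _ hbig hsmall]]]] := energy_dichotomy p12 hA v01.
have [a a2 Za] := boolean_centered qA.
have := hsmall _ _ a2 (sqr_ge0 _) Za => {}hsmall.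
have N0 : (0 : R) < 2 ^+ n by rewrite exprn_gt0.
have : qvar A / 16 < qvar A ^+ 2.
  by rewrite -(ltr_pM2l N0) mulrA; exact: lt_le_trans hbig hsmall.
move: v0 x16; set v := qvar A => v0 x16; rewrite expr2 ltr_pM2l // => v16.
have : v <= 17^-1.
  have -> : v = (expR (ln (1 / v)))^-1 by rewrite lnK ?posrE ?divr_gt0 // div1r invrK.
  rewrite lef_pV2 ?posrE ?expR_gt0 //.
  by have := expR_ge1Dx (ln (1 / v)); lra.
lra.
Qed.

End TwoAlternatives.

Theorem corollary4p1 (R : realType) :
  exists (c : R) (C C' : R -> R),
    [/\ 0 < c,
        forall p : R, 1 <= p < 2 -> 0 < C p /\ c * (2 - p) <= C p,
        forall p : R, 1 <= p <= 2 -> 0 < C' p /\ c <= C' p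
      & forall n : nat, (1 <= n)%N ->
          (forall (A : qop R n) (p : R), opnorm A <= 1 -> 1 <= p < 2 ->
             C p * log_bound p (qvar A) <= energy p A) /\
          (forall (A : qop R n) (p : R), quantum_boolean A -> 1 <= p <= 2 ->
             C' p * log_bound p (qvar A) <= energy p A)].
Proof.
exists 4096^-1, (fun p => 4096^-1 * (2 - p)), (fun=> 4096^-1).
have c0 : (0 : R) < 4096^-1 by rewrite invr_gt0 ltr0n.
split; first exact: c0.
- move=> p /andP[_ p2]; split; last exact: lexx.
  by rewrite mulr_gt0 // subr_gt0.
- by move=> p _; split; [exact: c0|exact: lexx].
- move=> n _; split=> A p hA hp; last exact: boolean_energy hA hp.
  exact: bounded_energy (opnorm_opbound hA) hp.
Qed.
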